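(* Let $V$ be a discrete valuation ring of mixed characteristic whose maximal ideal is generated by a prime integer $p$, let $X_1,\dots,X_n$ be indeterminates, and let $R=(V[X_1,\ldots,X_n])_{\mathfrak M}$ with $\mathfrak M=(p,X_1,\ldots,X_n)$ (an unramified regular local ring of mixed characteristic $p$). For an ideal $I=(f_1,\ldots,f_t)\subset R$ and an integer $i\geq 0$, assume that $p\notin \operatorname{Ass}_{\mathbb Z} H^{i}(\mathbf{f};R) \cup \operatorname{Ass}_{\mathbb Z} H^{i+1}(\mathbf{f};R)$, where $\mathbf f=f_1,\dots,f_t$. Let $S$ be any ramified regular local ring which can be obtained from $R$ via an Eisenstein extension. Then, for every ideal $J\subset S$ such that $\operatorname{rad}(J+pS)= \operatorname{rad}(IS+pS)$, the Bockstein homomorphism $\beta^{i-1}_{p,J}: H^{i-1}_J(S/pS)\rightarrow H^{i}_J(S/pS)$ is zero.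
   Context: $H^i(\mathbf f;R)$ denotes the $i$-th Koszul cohomology of the ring $R$ with respect to the sequence $\mathbf f=f_1,\dots,f_t$, and $H^i_J(-)$ denotes the $i$-th local cohomology with support in $J$ (zero for negative $i$). For a prime integer $p$ and an abelian group $M$, ''$p\notin\operatorname{Ass}_{\mathbb Z}M$'' means that $p\mathbb Z$ is not an associated prime of $M$ as a $\mathbb Z$-module (equivalently, multiplication by $p$ on $M$ is injective). A Noetherian local ring $(R,\mathfrak m,K)$ of mixed characteristic with residue field $K$ of characteristic $p$ is called unramified if $p\notin \mathfrak m^2$ and ramified if $p\in\mathfrak m^2$. For a normal local ring $(R,\mathfrak m)$, an Eisenstein polynomial is a monic polynomial $f(X)=X^d+a_1X^{d-1}+\cdots+a_d\in R[X]$ with $d\ge 1$, $a_j\in\mathfrak m$ for all $1\le j\le d$, and $a_d\notin\mathfrak m^2$; the local ring $S=R[X]/(f(X))$ is called an Eisenstein extension of $R$. The ideal $IS$ is the extension of $I$ along $R\to S$. Bockstein homomorphism: for a Noetherian ring $A$, an ideal $J\subset A$ and a nonzerodivisor $u\in A$, the short exact sequence $0\to A\xrightarrow{u}A\to A/uA\to 0$ induces a long exact sequence $$\cdots\to H^{i-1}_{J}(A/uA)\xrightarrow{\delta^{i-1}_{u,J}} H^{i}_{J}(A)\xrightarrow{u}H^{i}_{J}(A)\xrightarrow{\pi^i_{u,J}} H^{i}_{J}(A/uA) \to\cdots,$$ and $\beta^{i-1}_{u,J}:=\pi^i_{u,J}\circ\delta^{i-1}_{u,J}: H^{i-1}_J(A/uA)\to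 H^i_J(A/uA)$. Here $A=S$, $u=p$. *)

(* Defs.v *)
From HB Require Import structures.
From mathcomp Require Import all_boot all_order all_algebra.
From mathcomp Require Import zify ring.
From mathcomp Require Import boolp classical_sets.
From mathcomp Require Export mpoly.

Set Implicit Arguments.
Unset Strict Implicit.
Unset Printing Implicit Defensive.

Import Order.TTheory GRing.Theory Num.Theory.
Local Open Scope ring_scope.
Local Open Scope quotient_scope.

(* Cochain complexes of abelian groups, as one group [cochain] carrying      *)
(* subgroups [degree i] of homogeneous cochains.  Degrees are integers, so   *)
(* that negative ones need no special treatment.                             *)

Record complex := Complex {
  cochain :> zmodType;
  degree : int -> zmodClosed cochain;
  diff : {additive cochain -> cochain};
  diff_degree : forall i c, c \in degree i -> diff c \in degree (i + 1);
  diff_diff : forall c, diff (diff c) = 0 }.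

Section Cohomology.
Variables (C : complex) (i : int).

Definition is_cocycle : {pred C} := [pred c | (c \in degree C i) && (diff C c == 0)].

Fact is_cocycle_zmod : zmod_closed is_cocycle.
Proof.
split=> [|x y]; first by rewrite inE rpred0 raddf0 eqxx.
rewrite !inE => /andP[xi /eqP dx] /andP[yi /eqP dy].
by rewrite rpredB // raddfB dx dy subrr eqxx.
Qed.
HB.instance Definition _ := GRing.isZmodClosed.Build C is_cocycle is_cocycle_zmod.

Record cocycle := Cocycle { cocycle_val : C; cocycleP : cocycle_val \in is_cocycle }.
HB.instance Definition _ := [isSub for cocycle_val].
HB.instance Definition _ := [Choice of cocycle by <:].
HB.instance Definition _ := [SubChoice_isSubZmodule of cocycle by <:].

Definition is_coboundary : {pred cocycle} :=
  [pred z | `[< exists2 b : C, b \in degree C (i - 1) & val z = diff C b >]].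

Lemma is_coboundaryP z :
  reflect (exists2 b : C, b \in degree C (i - 1) & val z = diff C b)
          (z \in is_coboundary).
Proof. exact: asboolP. Qed.

Fact is_coboundary_zmod : zmod_closed is_coboundary.
Proof.
split=> [|x y]; first by apply/is_coboundaryP; exists 0; rewrite ?rpred0 ?raddf0.
move=> /is_coboundaryP[a ai ax] /is_coboundaryP[b bi bx]; apply/is_coboundaryP.
by exists (a - b); rewrite ?rpredB // !raddfB /= -ax -bx.
Qed.
HB.instance Definition _ :=
  GRing.isZmodClosed.Build cocycle is_coboundary is_coboundary_zmod.

Definition cohomology : zmodType := {ideal_quot is_coboundary}.

Definition class (z : cocycle) : cohomology := \pi z.

Lemma classE x : exists z, x = class z.
Proof. by exists (repr x); rewrite /class reprK. Qed.

Lemma class_eq x y : class x = class y <->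
  exists2 b : C, b \in degree C (i - 1) & val x - val y = diff C b.
Proof.
split=> [/eqP|[b bi e]].
  by rewrite -Quotient.idealrBE => /is_coboundaryP[b bi e]; exists b; rewrite -?raddfB.
apply/eqP; rewrite -Quotient.idealrBE; apply/is_coboundaryP.
by exists b; rewrite ?raddfB.
Qed.

End Cohomology.

Record cochain_map (C D : complex) := CochainMap {
  cmap :> {additive C -> D};
  cmap_degree : forall i c, c \in degree C i -> cmap c \in degree D i;
  cmap_diff : forall c, cmap (diff C c) = diff D (cmap c) }.

Section CohomologyMap.
Variables (C D : complex) (phi : cochain_map C D) (i : int).

Fact cmap_cocycle (z : cocycle C i) : phi (val z) \in @is_cocycle D i.
Proof.
have := cocycleP z; rewrite !inE => /andP[zi /eqP dz].
by rewrite cmap_degree //= -cmap_diff dz raddf0 eqxx.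
Qed.

Definition cohomology_map (x : cohomology C i) : cohomology D i :=
  class (Cocycle (cmap_cocycle (repr x))).

Lemma cohomology_mapE z : cohomology_map (class z) = class (Cocycle (cmap_cocycle z)).
Proof.
have /class_eq[b bi e] : class (repr (class z)) = class z by rewrite /class reprK.
by apply/class_eq; exists (phi b); rewrite ?cmap_degree //= -raddfB e cmap_diff.
Qed.

End CohomologyMap.

Section Connecting.
Variables (C' C C'' : complex) (alpha : cochain_map C' C) (gamma : cochain_map C C'').

(* [y] is obtained from [x] by the usual diagram chase. *)
Definition connecting_rel i (x : cohomology C'' i) (y : cohomology C' (i + 1)) : Prop :=
  exists (z : cocycle C'' i) (c : C) (w : cocycle C' (i + 1)),
    [/\ class z = x, c \in degree C i, gamma c = val z, alpha (val w) = diff C c & class w = y].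

Definition connecting i (x : cohomology C'' i) : cohomology C' (i + 1) :=
  xget 0 [set y | connecting_rel x y].

Definition short_exact : Prop :=
  [/\ injective alpha,
      forall i c, c \in degree C i ->
        (gamma c = 0 <-> exists2 a, a \in degree C' i & c = alpha a) &
      forall i b, b \in degree C'' i -> exists2 c, c \in degree C i & gamma c = b].

(* For short exact sequences the relation is a function, so that [connecting] *)
(* is the connecting homomorphism.                                            *)
Lemma connecting_rel_ex i x : short_exact -> exists y, @connecting_rel i x y.
Proof.
move=> [inj ex sur]; have [z ->] := classE x.
have := cocycleP z; rewrite inE => /andP[zi /eqP dz].
have [c ci cz] := sur _ _ zi.
have dci := diff_degree ci.
have [w wi dcw] : exists2 a, a \in degree C' (i + 1) & diff C c = alpha a.
  by apply/ex => //; rewrite cmap_diff cz dz.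
have wP : w \in @is_cocycle C' (i + 1).
  rewrite inE wi /=; apply/eqP/inj.
  by rewrite raddf0 cmap_diff -dcw diff_diff.
by exists (class (Cocycle wP)), z, c, (Cocycle wP).
Qed.

Lemma connecting_rel_uniq i x y1 y2 : short_exact ->
  @connecting_rel i x y1 -> @connecting_rel i x y2 -> y1 = y2.
Proof.
move=> [inj ex sur] [z1 [c1 [w1 [<- c1i gc1 aw1 <-]]]] [z2 [c2 [w2 [/esym e c2i gc2 aw2 <-]]]].
move: e => /class_eq[b bi e].
have [b' b'i b'b] := sur _ _ bi.
have db'i : diff C b' \in degree C i by rewrite -[i](subrK 1) diff_degree.
have [||a ai ae] := (ex i (c1 - c2 - diff C b') _).1.
- by rewrite !rpredB.
- by rewrite !raddfB cmap_diff /= b'b gc1 gc2 /= -e subrr.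
apply/class_eq; exists a; first by rewrite addrK.
apply: inj; rewrite raddfB /= aw1 aw2 cmap_diff -ae !raddfB /= diff_diff subr0.
by [].
Qed.

Lemma connectingP i x : short_exact -> @connecting_rel i x (connecting x).
Proof.
move=> se; have [y xy] := connecting_rel_ex x se.
by rewrite /connecting; case: xgetP => [y' _|/(_ y)] //.
Qed.

Lemma connecting_additive i : short_exact ->
  {morph @connecting i : x y / x + y}.
Proof.
move=> se x y; apply: (connecting_rel_uniq (x := x + y)) => //.
  exact: connectingP.
have [z1 [c1 [w1 [<- c1i g1 a1 <-]]]] := connectingP x se.
have [z2 [c2 [w2 [<- c2i g2 a2 <-]]]] := connectingP y se.
exists (z1 + z2), (c1 + c2), (w1 + w2); split.
- by rewrite /class raddfD.
- by rewrite rpredD.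
- by rewrite raddfD g1 g2.
- by rewrite !raddfD /= a1 a2.
- by rewrite /class raddfD.
Qed.

End Connecting.

(* The complex with [F S] placed in degree [#|S|], for a functor [F] on the   *)
(* poset of subsets of {0, ..., k - 1}.  Both the Koszul complex and the      *)
(* Cech complex have this shape.                                              *)

Record cube (k : nat) := Cube {
  vertex :> {set 'I_k} -> zmodType;
  edge : forall S T : {set 'I_k}, S \subset T -> {additive vertex S -> vertex T};
  edge_comp : forall (S T U : {set 'I_k}) (ST : S \subset T) (TU : T \subset U)
    (SU : S \subset U) x, edge TU (edge ST x) = edge SU x }.

Section CubeComplex.
Variables (k : nat) (F : cube k).

Definition cube_cochain := {dffun forall S : {set 'I_k}, F S}.
HB.instance Definition _ := Choice.on cube_cochain.

Definition cube_add (c c' : cube_cochain) : cube_cochain := [ffun S => c S + c' S].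
Definition cube_opp (c : cube_cochain) : cube_cochain := [ffun S => - c S].
Definition cube_zero : cube_cochain := [ffun S => 0].

Fact cube_addA : associative cube_add.
Proof. by move=> a b c; apply/ffunP => S; rewrite !ffunE addrA. Qed.
Fact cube_addC : commutative cube_add.
Proof. by move=> a b; apply/ffunP => S; rewrite !ffunE addrC. Qed.
Fact cube_add0 : left_id cube_zero cube_add.
Proof. by move=> a; apply/ffunP => S; rewrite !ffunE add0r. Qed.
Fact cube_addN : left_inverse cube_zero cube_opp cube_add.
Proof. by move=> a; apply/ffunP => S; rewrite !ffunE addNr. Qed.
HB.instance Definition _ :=
  GRing.isZmodule.Build cube_cochain cube_addA cube_addC cube_add0 cube_addN.

Lemma cubeD (c c' : cube_cochain) S : (c + c') S = c S + c' S.
Proof. exact: ffunE. Qed.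
Lemma cubeN (c : cube_cochain) S : (- c) S = - c S.
Proof. exact: ffunE. Qed.
Lemma cube0 S : (0 : cube_cochain) S = 0.
Proof. exact: ffunE. Qed.

Definition cube_homog (i : int) : {pred cube_cochain} :=
  [pred c : cube_cochain | [forall S : {set 'I_k}, (#|S|%:Z != i) ==> (c S == 0)]].

Lemma cube_homogP i (c : cube_cochain) :
  reflect (forall S : {set 'I_k}, #|S|%:Z != i -> c S = 0) (c \in cube_homog i).
Proof.
apply: (iffP forallP) => h S; first by move=> Si; have /implyP/(_ Si)/eqP := h S.
by apply/implyP => Si; rewrite h.
Qed.

Fact cube_homog_zmod i : zmod_closed (cube_homog i).
Proof.
split=> [|x y]; first by apply/cube_homogP => S _; rewrite cube0.
move=> /cube_homogP hx /cube_homogP hy; apply/cube_homogP => S Si.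
by rewrite cubeD cubeN hx // hy // subr0.
Qed.
HB.instance Definition _ i :=
  GRing.isZmodClosed.Build cube_cochain (cube_homog i) (cube_homog_zmod i).

Definition cube_diff (c : cube_cochain) : cube_cochain :=
  [ffun T : {set 'I_k} => \sum_(j in T)
     edge F (subD1set T j) (c (T :\ j)) *~ (-1) ^+ #|[set l in T | (l < j)%N]|].

Fact cube_diff_additive : zmod_morphism cube_diff.
Proof.
move=> a b; apply/ffunP => T; rewrite cubeD cubeN !ffunE -sumrB.
by apply: eq_bigr => j _; rewrite cubeD cubeN raddfB mulrzBl.
Qed.
HB.instance Definition _ :=
  GRing.isZmodMorphism.Build cube_cochain cube_cochain cube_diff cube_diff_additive.

Fact cube_diff_degree i c : c \in cube_homog i -> cube_diff c \in cube_homog (i + 1).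
Proof.
move=> /cube_homogP hc; apply/cube_homogP => T Ti; rewrite ffunE.
apply: big1 => j jT; rewrite hc ?raddf0 ?mul0rz //.
apply: contra Ti => /eqP <-; rewrite (cardsD1 j T) jT addnC.
by rewrite PoszD.
Qed.

Lemma edge_congr (S S' T : {set 'I_k}) (ST : S \subset T) (ST' : S' \subset T) (c : cube_cochain) :
  S = S' -> edge F ST (c S) = edge F ST' (c S').
Proof. by move=> e; case: _ / e ST' => ST'; congr (edge F _ _); apply: bool_irrelevance. Qed.

Fact cube_diff_diff c : cube_diff (cube_diff c) = 0.
Proof.
apply/ffunP => T; rewrite cube0 ffunE.
pose s (T : {set 'I_k}) (j : 'I_k) := #|[set l in T | (l < j)%N]|.
have sub j l : T :\ j :\ l \subset T by rewrite (fintype.subset_trans (subD1set _ _)) ?subD1set.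
pose x j l := edge F (sub j l) (c (T :\ j :\ l)).
have xC j l : x j l = x l j by apply: edge_congr; apply/setP => m; rewrite !inE andbCA.
transitivity (\sum_(j in T) \sum_(l in T :\ j) x j l *~ (-1) ^+ (s T j + s (T :\ j) l)).
  apply: eq_bigr => j jT; rewrite ffunE raddf_sum mulrz_suml.
  apply: eq_bigr => l _.
  rewrite raddfMz (edge_comp _ _ (sub j l)) -mulrzA; congr (_ *~ _).
  by rewrite exprD mulrC.
rewrite pair_big_dep /=.
rewrite (bigID (fun q : 'I_k * 'I_k => (q.1 < q.2)%N)) /=.
rewrite [X in _ + X](reindex_inj (h := fun q : 'I_k * 'I_k => (q.2, q.1))) /=; last by case=> ? ? [? ?] [-> ->].
apply/eqP; rewrite addr_eq0 -sumrN; apply/eqP.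
have lem (q : 'I_k * 'I_k) :
    [&& q.2 \in T, q.1 \in T :\ q.2 & ~~ (q.2 < q.1)%N] =
    [&& q.1 \in T, q.2 \in T :\ q.1 & (q.1 < q.2)%N].
  rewrite !inE -leqNgt; case: q => j l /=.
  rewrite ltn_neqAle eq_sym -(inj_eq val_inj) /=.
  by case: (l \in T); case: (j \in T); rewrite ?andbF //= eq_sym ?andbb //; case: eqP.
apply: eq_big => [q|[j l] /=].
  by rewrite -andbA -lem andbA.
move=> /andP[/andP[jT]]; rewrite !inE => /andP[lj lT] jl.
rewrite [x l j]xC -mulrNz; congr (_ *~ _).
have e1 : s T l = (s (T :\ j) l).+1.
  rewrite /s (cardsD1 j) !inE jT jl add1n; congr _.+1; apply: eq_card => m.
  by rewrite !inE andbA.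
have e2 : s (T :\ l) j = s T j.
  apply: eq_card => m; rewrite !inE; case: eqP => [->|//] /=.
  by rewrite ltnNge (ltnW jl) andbF.
by rewrite e1 e2 addSn exprS mulN1r opprK addnC.
Qed.

Definition cube_complex : complex :=
  Complex (degree := fun i => cube_homog i) cube_diff_degree cube_diff_diff.

End CubeComplex.

Section Koszul.
Variables (A : comNzRingType) (k : nat) (f : 'I_k -> A) (M : lmodType A).

(* In the differential only [S = T :\ j] with [j \in T] occurs: see           *)
(* [koszul_edgeD1].                                                           *)
Definition koszul_edge (S T : {set 'I_k}) (_ : S \subset T) (x : M) : M :=
  (\prod_(j in T :\: S) f j) *: x.

Fact koszul_edge_additive (S T : {set 'I_k}) (ST : S \subset T) : zmod_morphism (koszul_edge ST).
Proof. by move=> x y; rewrite /koszul_edge scalerBr. Qed.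
HB.instance Definition _ (S T : {set 'I_k}) (ST : S \subset T) :=
  GRing.isZmodMorphism.Build M M (koszul_edge ST) (koszul_edge_additive ST).

Lemma prod_setD (S T U : {set 'I_k}) : S \subset T -> T \subset U ->
  \prod_(j in U :\: S) f j = (\prod_(j in U :\: T) f j) * \prod_(j in T :\: S) f j.
Proof.
move=> ST TU; rewrite (big_setID T) mulrC /=; congr (_ * _); apply: eq_bigl => j.
all: rewrite !inE; move: (fintype.subsetP ST j) (fintype.subsetP TU j).
all: by case: (j \in S); case: (j \in T); case: (j \in U) => //= ST' TU';
  solve [exact: ST' | exact: TU' | have := ST' isT | have := TU' isT].
Qed.

Fact koszul_edge_comp (S T U : {set 'I_k}) (ST : S \subset T) (TU : T \subset U)
  (SU : S \subset U) x : koszul_edge TU (koszul_edge ST x) = koszul_edge SU x.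
Proof. by rewrite /koszul_edge scalerA -prod_setD. Qed.

Lemma koszul_edgeD1 (T : {set 'I_k}) j x :
  j \in T -> koszul_edge (subD1set T j) x = f j *: x.
Proof.
move=> jT; rewrite /koszul_edge (big_pred1 j) // => l.
by rewrite !inE; case: eqP => [->|_]; rewrite ?jT //=; case: (l \in T).
Qed.

Definition koszul : complex := cube_complex (Cube koszul_edge_comp).

End Koszul.

Section Localization.
Variables (A : comNzRingType) (M : lmodType A) (s : A).

(* [M_s], as classes of pairs [(m, a)] standing for [m / s ^+ a].            *)
Definition frac_rel : rel (M * nat) := fun x y =>
  `[< exists c, s ^+ (c + y.2) *: x.1 = s ^+ (c + x.2) *: y.1 >].

Fact frac_equiv : equiv_class_of frac_rel.
Proof.
split=> [x|x y|y x z].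
- by apply/asboolP; exists 0%N.
- by apply/asboolP/asboolP => -[c e]; exists c.
move=> /asboolP[c e] /asboolP[c' e']; apply/asboolP; exists (c + c' + y.2)%N.
transitivity (s ^+ (c' + z.2) *: (s ^+ (c + y.2) *: x.1)).
  by rewrite scalerA -exprD; congr (_ ^+ _ *: _); lia.
rewrite e scalerA mulrC -scalerA e' scalerA -exprD; congr (_ ^+ _ *: _); lia.
Qed.

Canonical frac_equivRel := EquivRelPack frac_equiv.
Canonical frac_encModRel := defaultEncModRel frac_rel.

Definition modloc := {eq_quot frac_rel}.
HB.instance Definition _ := Choice.on modloc.
HB.instance Definition _ := EqQuotient.on modloc.

Definition frac (m : M) (a : nat) : modloc := \pi_modloc (m, a).

Lemma fracP x : exists m a, x = frac m a.
Proof. by exists (repr x).1, (repr x).2; rewrite /frac -surjective_pairing reprK. Qed.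

Lemma frac_eq m a n b :
  frac m a = frac n b <-> exists c, s ^+ (c + b) *: m = s ^+ (c + a) *: n.
Proof.
split=> [/eqP|e]; first by rewrite /frac eqmodE => /asboolP.
by apply/eqP; rewrite /frac eqmodE; apply/asboolP.
Qed.

Lemma frac_repr m a :
  exists c, s ^+ (c + a) *: (repr (frac m a)).1 = s ^+ (c + (repr (frac m a)).2) *: m.
Proof. by apply/frac_eq; rewrite /frac -surjective_pairing reprK. Qed.

Definition modloc_add (x y : modloc) : modloc :=
  frac (s ^+ (repr y).2 *: (repr x).1 + s ^+ (repr x).2 *: (repr y).1)
       ((repr x).2 + (repr y).2).
Definition modloc_opp (x : modloc) : modloc := frac (- (repr x).1) (repr x).2.

Lemma modloc_addE m a n b :
  modloc_add (frac m a) (frac n b) = frac (s ^+ b *: m + s ^+ a *: n) (a + b).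
Proof.
apply/frac_eq; have [c] := frac_repr m a; have [c'] := frac_repr n b.
case: (repr _) => n' b'; case: (repr _) => m' a' /= en em.
exists (c + c')%N; rewrite !scalerDr !scalerA -!exprD; congr (_ + _).
  transitivity (s ^+ (c' + b + b') *: (s ^+ (c + a) *: m')).
    by rewrite scalerA -exprD; congr (_ ^+ _ *: _); lia.
  by rewrite em scalerA -exprD; congr (_ ^+ _ *: _); lia.
transitivity (s ^+ (c + a + a') *: (s ^+ (c' + b) *: n')).
  by rewrite scalerA -exprD; congr (_ ^+ _ *: _); lia.
by rewrite en scalerA -exprD; congr (_ ^+ _ *: _); lia.
Qed.

Lemma modloc_oppE m a : modloc_opp (frac m a) = frac (- m) a.
Proof.
apply/frac_eq; have [c e] := frac_repr m a; exists c.
by rewrite !scalerN e.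
Qed.

Fact modloc_addA : associative modloc_add.
Proof.
move=> x y z; have [m [a ->]] := fracP x; have [n [b ->]] := fracP y.
have [l [c ->]] := fracP z; rewrite !modloc_addE addnA; congr frac.
by rewrite !scalerDr !scalerA -!exprD addrA (addnC c b) (addnC c a).
Qed.
Fact modloc_addC : commutative modloc_add.
Proof.
move=> x y; have [m [a ->]] := fracP x; have [n [b ->]] := fracP y.
by rewrite !modloc_addE addnC addrC.
Qed.
Fact modloc_add0 : left_id (frac 0 0) modloc_add.
Proof.
move=> x; have [m [a ->]] := fracP x.
by rewrite modloc_addE scaler0 add0r expr0 scale1r add0n.
Qed.
Fact modloc_addN : left_inverse (frac 0 0) modloc_opp modloc_add.
Proof.
move=> x; have [m [a ->]] := fracP x.
rewrite modloc_oppE modloc_addE scalerN addNr; apply/frac_eq; exists 0%N.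
by rewrite !scaler0.
Qed.
HB.instance Definition _ :=
  GRing.isZmodule.Build modloc modloc_addA modloc_addC modloc_add0 modloc_addN.

Lemma fracD m a n b : frac m a + frac n b = frac (s ^+ b *: m + s ^+ a *: n) (a + b).
Proof. exact: modloc_addE. Qed.

Lemma fracN m a : - frac m a = frac (- m) a.
Proof. exact: modloc_oppE. Qed.

Lemma frac_eq0 m a : frac m a = 0 <-> exists c, s ^+ c *: m = 0.
Proof.
split=> [/frac_eq[c e]|[c e]]; last apply/frac_eq; exists c.
  by move: e; rewrite scaler0 addn0.
by rewrite addn0 e scaler0.
Qed.

End Localization.

Arguments frac {A M} s m a.

Section LocalizationMaps.
Variable A : comNzRingType.

(* [m / s ^+ a] is sent to [phi m / s ^+ a] and, when [t = r * s], to        *)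
(* [r ^+ a *: m / t ^+ a], respectively.                                     *)
Definition modloc_fun (M N : lmodType A) (phi : M -> N) s (x : modloc M s) : modloc N s :=
  frac s (phi (repr x).1) (repr x).2.

Definition modloc_widen (M : lmodType A) (s t r : A) (_ : t = r * s)
  (x : modloc M s) : modloc M t := frac t (r ^+ (repr x).2 *: (repr x).1) (repr x).2.

Lemma modloc_funE (M N : lmodType A) (phi : {linear M -> N}) s m a :
  modloc_fun phi (frac s m a) = frac s (phi m) a.
Proof.
apply/frac_eq; have [c e] := frac_repr s m a; exists c.
by rewrite -!linearZ e.
Qed.

Lemma modloc_widenE (M : lmodType A) s t r (tE : t = r * s) m a :
  modloc_widen tE (frac s m a) = frac t (r ^+ a *: m) a :> modloc M t.
Proof.
apply/frac_eq; have [c] := frac_repr s m a; case: (repr _) => m' a' /= e.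
exists c; rewrite tE !exprMn !scalerA.
have -> : r ^+ (c + a) * s ^+ (c + a) * r ^+ a' = r ^+ (c + a + a') * s ^+ (c + a).
  by rewrite mulrAC -exprD.
have -> : r ^+ (c + a') * s ^+ (c + a') * r ^+ a = r ^+ (c + a + a') * s ^+ (c + a').
  by rewrite mulrAC -exprD addnAC.
by rewrite -!scalerA e.
Qed.

Fact modloc_fun_additive (M N : lmodType A) (phi : {linear M -> N}) s :
  zmod_morphism (modloc_fun phi (s := s)).
Proof.
move=> x y; have [m [a ->]] := fracP x; have [n [b ->]] := fracP y.
by rewrite fracN fracD !modloc_funE fracN fracD linearD !linearZ linearN.
Qed.
HB.instance Definition _ (M N : lmodType A) (phi : {linear M -> N}) s :=
  GRing.isZmodMorphism.Build (modloc M s) (modloc N s) (modloc_fun phi (s := s))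
    (modloc_fun_additive phi (s := s)).

Fact modloc_widen_additive (M : lmodType A) s t r (tE : t = r * s) :
  zmod_morphism (@modloc_widen M s t r tE).
Proof.
move=> x y; have [m [a ->]] := fracP x; have [n [b ->]] := fracP y.
rewrite fracN fracD !modloc_widenE fracN fracD; congr frac.
rewrite tE !exprMn scalerDr !scalerN !scalerA; congr (_ - _); congr (_ *: _).
  by rewrite exprD; ring.
by rewrite exprD; ring.
Qed.
HB.instance Definition _ (M : lmodType A) s t r (tE : t = r * s) :=
  GRing.isZmodMorphism.Build (modloc M s) (modloc M t) (@modloc_widen M s t r tE)
    (modloc_widen_additive tE).

End LocalizationMaps.

Section Cech.
Variables (A : comNzRingType) (k : nat) (g : 'I_k -> A).

Definition gprod (S : {set 'I_k}) : A := \prod_(j in S) g j.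

Lemma gprodM (S T : {set 'I_k}) : S \subset T -> gprod T = gprod (T :\: S) * gprod S.
Proof.
move=> ST; rewrite /gprod (big_setID S) mulrC /=; congr (_ * _).
by rewrite (finset.setIidPr ST).
Qed.

Section CechModule.
Variable M : lmodType A.

Definition cech_edge (S T : {set 'I_k}) (ST : S \subset T) :
  {additive modloc M (gprod S) -> modloc M (gprod T)} := modloc_widen (gprodM ST).

Fact cech_edge_comp (S T U : {set 'I_k}) (ST : S \subset T) (TU : T \subset U)
  (SU : S \subset U) x : cech_edge TU (cech_edge ST x) = cech_edge SU x.
Proof.
have [m [a ->]] := fracP x.
by rewrite /= !modloc_widenE scalerA -exprMn -prod_setD.
Qed.

Definition cech_cube : cube k := Cube cech_edge_comp.
Definition cech : complex := cube_complex cech_cube.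

End CechModule.


Section CechMap.
Variables (M N : lmodType A) (phi : {linear M -> N}).

Definition cech_fun (c : cube_cochain (cech_cube M)) : cube_cochain (cech_cube N) :=
  [ffun S => modloc_fun phi (c S)].

Fact cech_fun_additive : zmod_morphism cech_fun.
Proof.
move=> a b; apply/ffunP => S; rewrite cubeD cubeN !ffunE.
exact: (modloc_fun_additive phi).
Qed.
HB.instance Definition _ :=
  GRing.isZmodMorphism.Build _ _ cech_fun cech_fun_additive.

Fact cech_fun_degree i c : c \in degree (cech M) i -> cech_fun c \in degree (cech N) i.
Proof.
move=> /cube_homogP hc; apply/cube_homogP => S Si.
by rewrite ffunE hc // -[LHS]/(modloc_fun phi 0) raddf0.
Qed.

Fact cech_fun_diff c : cech_fun (diff (cech M) c) = diff (cech N) (cech_fun c).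
Proof.
apply/ffunP => T; rewrite !ffunE raddf_sum; apply: eq_bigr => j _.
rewrite ffunE raddfMz; congr (_ *~ _).
have [m [a ->]] := fracP (c (T :\ j)).
by rewrite /= modloc_funE !modloc_widenE modloc_funE linearZ.
Qed.

Definition cech_map : cochain_map (cech M) (cech N) :=
  @CochainMap (cech M) (cech N) cech_fun cech_fun_degree cech_fun_diff.

End CechMap.
End Cech.

Section Quotient.
Variables (A : comNzRingType) (u : A) (M : lmodType A).

Definition multiples : {pred M} := [pred m | `[< exists m', m = u *: m' >]].

Lemma multiplesP m : reflect (exists m', m = u *: m') (m \in multiples).
Proof. exact: asboolP. Qed.

Fact multiples_zmod : zmod_closed multiples.
Proof.
split=> [|x y]; first by apply/multiplesP; exists 0; rewrite scaler0.
move=> /multiplesP[a ->] /multiplesP[b ->]; apply/multiplesP.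
by exists (a - b); rewrite scalerBr.
Qed.
HB.instance Definition _ := GRing.isZmodClosed.Build M multiples multiples_zmod.

(* [M / u M]                                                                  *)
Definition modquot := {ideal_quot multiples}.
HB.instance Definition _ := GRing.Zmodule.on modquot.

Definition to_quot (m : M) : modquot := \pi_modquot m.

Lemma to_quotP x : exists m, x = to_quot m.
Proof. by exists (repr x); rewrite /to_quot reprK. Qed.

Lemma to_quot_eq m n : to_quot m = to_quot n <-> exists m', m - n = u *: m'.
Proof.
split=> [/eqP|e]; first by rewrite -Quotient.idealrBE => /multiplesP.
by apply/eqP; rewrite -Quotient.idealrBE; apply/multiplesP.
Qed.

Fact to_quot_additive : zmod_morphism to_quot.
Proof. exact: raddfB. Qed.
HB.instance Definition _ := GRing.isZmodMorphism.Build M modquot to_quot to_quot_additive.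

Definition modquot_scale (a : A) (x : modquot) : modquot := to_quot (a *: repr x).

Lemma modquot_scaleE a m : modquot_scale a (to_quot m) = to_quot (a *: m).
Proof.
have /to_quot_eq[n e] : to_quot (repr (to_quot m)) = to_quot m by rewrite /to_quot reprK.
by apply/to_quot_eq; exists (a *: n); rewrite -scalerBr e !scalerA mulrC.
Qed.

Fact modquot_scaleA a b x : modquot_scale a (modquot_scale b x) = modquot_scale (a * b) x.
Proof. by have [m ->] := to_quotP x; rewrite !modquot_scaleE scalerA. Qed.
Fact modquot_scale1 : left_id 1 modquot_scale.
Proof. by move=> x; have [m ->] := to_quotP x; rewrite modquot_scaleE scale1r. Qed.
Fact modquot_scaleDr : right_distributive modquot_scale +%R.
Proof.
move=> a x y; have [m ->] := to_quotP x; have [n ->] := to_quotP y.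
by rewrite -raddfD !modquot_scaleE scalerDr raddfD.
Qed.
Fact modquot_scaleDl x : {morph modquot_scale^~ x : a b / a + b}.
Proof. by move=> a b; have [m ->] := to_quotP x; rewrite !modquot_scaleE scalerDl raddfD. Qed.
HB.instance Definition _ := GRing.Zmodule_isLmodule.Build A modquot
  modquot_scaleA modquot_scale1 modquot_scaleDr modquot_scaleDl.

Fact to_quot_scalable : scalable to_quot.
Proof. by move=> a m; exact/esym/modquot_scaleE. Qed.
HB.instance Definition _ := GRing.isScalable.Build A M modquot *:%R to_quot to_quot_scalable.

Definition scale_by (m : M) : M := u *: m.
Fact scale_by_linear : linear scale_by.
Proof. by move=> a m n; rewrite /scale_by scalerDr !scalerA mulrC. Qed.
HB.instance Definition _ := GRing.isLinear.Build A M M *:%R scale_by scale_by_linear.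

End Quotient.

Section LocalCohomology.
Variables (A : comNzRingType) (k : nat) (g : 'I_k -> A).

(* Local cohomology with support in the ideal generated by [g], as the        *)
(* cohomology of the Cech complex on [g].                                     *)
Definition loc_cohomology (M : lmodType A) (i : int) : zmodType :=
  cohomology (cech g M) i.

Variable u : A.

Definition bockstein_delta (i : int) :
    loc_cohomology (modquot u A^o) i -> loc_cohomology A^o (i + 1) :=
  connecting (cech_map g (scale_by u (M := A^o))) (cech_map g (to_quot u (M := A^o))) (i := i).

Definition bockstein_pi (i : int) :
    loc_cohomology A^o i -> loc_cohomology (modquot u A^o) i :=
  cohomology_map (cech_map g (to_quot u (M := A^o))) (i := i).

Definition bockstein (i : int) :
    loc_cohomology (modquot u A^o) i -> loc_cohomology (modquot u A^o) (i + 1) :=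
  fun x => bockstein_pi (bockstein_delta x).

Definition nonzerodivisor := forall a : A, u * a = 0 -> a = 0.
Local Notation mul_u := (scale_by u (M := A^o)).
Local Notation mod_u := (to_quot u (M := A^o)).

Lemma modloc_mul_inj s : nonzerodivisor -> injective (modloc_fun mul_u (s := s)).
Proof.
move=> u_reg x y; have [m [a ->]] := fracP x; have [n [b ->]] := fracP y.
rewrite !modloc_funE => /frac_eq[c e]; apply/frac_eq; exists c.
apply/eqP; rewrite -subr_eq0; apply/eqP/u_reg.
have e' : s ^+ (c + b) * (u * m) = s ^+ (c + a) * (u * n) := e.
by rewrite -[LHS]/(u * (s ^+ (c + b) * m - s ^+ (c + a) * n)) mulrBr mulrCA e' mulrCA subrr.
Qed.

Lemma modloc_mod_ker s x : modloc_fun mod_u (s := s) x = 0 ->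
  exists y, modloc_fun mul_u y = x.
Proof.
have [m [a ->]] := fracP x; rewrite modloc_funE => /frac_eq0[c].
rewrite -linearZ -[X in _ = X](raddf0 mod_u) => /to_quot_eq[n]; rewrite subr0 => e.
exists (frac s n (a + c)); rewrite modloc_funE; apply/frac_eq; exists 0%N.
by rewrite /= /scale_by -e scalerA -exprD.
Qed.

Lemma modloc_mod_sur s y : exists x, modloc_fun mod_u (s := s) x = y.
Proof.
have [q [a ->]] := fracP y; have [m ->] := to_quotP q.
by exists (frac s m a); rewrite modloc_funE.
Qed.

Lemma cech_short_exact :
  nonzerodivisor -> short_exact (cech_map g mul_u) (cech_map g mod_u).
Proof.
move=> u_reg; split.
- move=> b c e; apply/ffunP => S.
  have := congr1 (fun f : cube_cochain (cech_cube g A^o) => f S) e.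
  by rewrite !ffunE; apply: (modloc_mul_inj u_reg).
- move=> i c /cube_homogP ci; split=> [c0|[b bi ->]]; last first.
    apply/ffunP => S; rewrite !ffunE.
    have [m [a ->]] := fracP ((b : cube_cochain (cech_cube g A^o)) S).
    rewrite !modloc_funE; apply/frac_eq0; exists 0%N.
    rewrite expr0 scale1r -(raddf0 mod_u); apply/to_quot_eq; exists m.
    by rewrite subr0.
  have lift S : exists y, modloc_fun mul_u y = (c : cube_cochain (cech_cube g A^o)) S.
    apply: modloc_mod_ker.
    have := congr1 (fun f : cube_cochain (cech_cube g _) => f S) c0.
    by rewrite !ffunE.
  pose b : cube_cochain (cech_cube g A^o) := [ffun S => projT1 (cid (lift S))].
  have bE S : modloc_fun mul_u (b S) = (c : cube_cochain (cech_cube g A^o)) S.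
    by rewrite ffunE; case: cid.
  exists b; last by apply/ffunP => S; rewrite ffunE bE.
  apply/cube_homogP => S Si; apply: (modloc_mul_inj u_reg); rewrite bE ci //.
  by rewrite raddf0.
move=> i b /cube_homogP bi.
pose c : cube_cochain (cech_cube g A^o) := [ffun S : {set 'I_k} => if #|S|%:Z == i
  then projT1 (cid (modloc_mod_sur ((b : cube_cochain (cech_cube g _)) S))) else 0].
exists c; first by apply/cube_homogP => S /negPf Si; rewrite ffunE Si.
apply/ffunP => S; rewrite !ffunE; case: ifPn => [_|Si]; first by case: cid.
by rewrite raddf0 bi.
Qed.

(* When [u] is a nonzerodivisor, [bockstein_delta] is thus the connecting     *)
(* homomorphism.                                                              *)
Lemma bockstein_deltaP i x : nonzerodivisor ->
  connecting_rel (cech_map g mul_u) (cech_map g mod_u) x (@bockstein_delta i x).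
Proof. by move=> u_reg; apply/connectingP/cech_short_exact. Qed.

End LocalCohomology.

(* p Z is the annihilator of some element of M.                               *)
Definition assZ (p : nat) (M : zmodType) : Prop :=
  exists m : M, forall n : int, m *~ n = 0 <-> (p%:Z %| n)%Z.

Local Open Scope classical_set_scope.

Section Ideals.
Variable A : comNzRingType.

Definition is_ideal (I : set A) : Prop :=
  [/\ I 0, forall x y, I x -> I y -> I (x + y) & forall a x, I x -> I (a * x)].

Definition ideal_gen (G : set A) : set A := smallest is_ideal G.

Definition radical (I : set A) : set A := [set x | exists m, I (x ^+ m)].

Definition is_prime_ideal (P : set A) : Prop :=
  [/\ is_ideal P, ~ P 1 & forall a b, P (a * b) -> P a \/ P b].

Definition noetherian : Prop := forall I : set A, is_ideal I ->
  exists k, exists g : 'I_k -> A, I = ideal_gen (range g).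

Definition has_prime_chain (d : nat) : Prop := exists P : nat -> set A,
  (forall j, (j <= d)%N -> is_prime_ideal (P j)) /\
  (forall j, (j < d)%N -> P j `<` P j.+1).

Definition has_krull_dim (d : nat) : Prop :=
  has_prime_chain d /\ forall e, has_prime_chain e -> (e <= d)%N.

End Ideals.

Section LocalRings.
Variable A : comUnitRingType.

Definition nonunits : set A := [set x | x \isn't a GRing.unit].

(* [nonunits] is then the maximal ideal.                                      *)
Definition local_ring : Prop := is_ideal nonunits.

Definition max_sq : set A := ideal_gen [set x * y | x in nonunits & y in nonunits].

Definition regular_local : Prop :=
  [/\ noetherian A, local_ring &
      exists2 d, has_krull_dim A d &
        exists g : 'I_d -> A, nonunits = ideal_gen (range g)].

Definition mixed_char (p : nat) : Prop :=
  [/\ prime p, forall n, n%:R = 0 :> A -> n = 0%N & nonunits p%:R].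

Definition ramified (p : nat) : Prop :=
  [/\ noetherian A, local_ring, mixed_char p & max_sq p%:R].

(* The leading coefficient is [f`_(size f).-1], and [f`_0] is the constant    *)
(* term.                                                                      *)
Definition eisenstein (f : {poly A}) : Prop :=
  [/\ f \is monic, (1 < size f)%N,
      forall j, (j < (size f).-1)%N -> nonunits f`_j & ~ max_sq f`_0].

End LocalRings.

Definition is_dvr (V : idomainType) : Prop :=
  [/\ local_ring V,
      forall I : set V, is_ideal I -> exists x, I = ideal_gen [set x] &
      exists2 x : V, x != 0 & nonunits x].

(* [phi] identifies [A] with the localization of [B] at the prime ideal [P].  *)
Definition is_localization_at (B : comNzRingType) (P : set B) (A : comUnitRingType)
    (phi : {rmorphism B -> A}) : Prop :=
  [/\ forall s, ~ P s -> phi s \is a GRing.unit,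
      forall a, exists b s, ~ P s /\ a = phi b / phi s &
      forall b, phi b = 0 -> exists2 s, ~ P s & s * b = 0].

(* [phi] identifies [A] with [B / I].                                         *)
Definition is_quotient_by (B : comNzRingType) (I : set B) (A : comNzRingType)
    (phi : {rmorphism B -> A}) : Prop :=
  (forall a, exists b, phi b = a) /\ forall b, phi b = 0 <-> I b.

(* Main.v *)
(** The Bockstein map vanishes as soon as every Cech cocycle modulo [p] lifts,
    up to the transition maps of the direct system of Koszul complexes on powers
    of the generators, to a cocycle modulo [p^2].  This lifting property depends
    only on the radical of [J + p] and passes to free ring extensions, so it is
    enough to prove it over [R] for the sequence [f].  There torsion-freeness
    gives it for the Koszul complex of [f] itself.  The ring [R / p^2] carries a
    lift [phi] of Frobenius, and Frobenius is flat on [R / p], so the property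
    holds for the Koszul complexes of all [phi^e f]; as [phi^e f = f^(p^e)] modulo
    [p], hence [(phi^e f)^p = f^(p^(e+1))] modulo [p^2], these are cofinal among
    the Koszul complexes on powers of [f].

    The residue field of [V] may be imperfect and [V] need not be complete; the
    lift of Frobenius is then obtained from Zorn's lemma, one [p]-th root at a
    time. *)
Require Import Defs.
From HB Require Import structures.
From mathcomp Require Import all_boot all_order all_algebra.
From mathcomp Require Import zify ring.
From mathcomp Require Import boolp classical_sets.
From mathcomp Require Import mpoly.

Set Implicit Arguments.
Unset Strict Implicit.
Unset Printing Implicit Defensive.

Import Order.TTheory GRing.Theory Num.Theory.
Local Open Scope ring_scope.

(** The lifting property is moved to [S] because Frobenius cannot be used there: [p] lies in the
    square of the maximal ideal of the regular ring [S], so [S / p] is not regular and its Frobenius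
    is not flat. Frobenius therefore stays over [R], and what reaches [S] is a condition that is
    linear over [R] and can be read on coordinates in a basis. Since [J] and [I S] agree only up to
    radicals and modulo [p], the condition must not depend on the chosen sequence. Elements are
    exchanged one at a time: the Koszul complex with one more element is the mapping cone of
    multiplication by that element, and a power of an element of the radical is homotopic to zero.
    The modulus [p ^+ 2] is the exact range of the Bockstein map, and it is also where [p]-th powers
    are rigid: elements congruent modulo [p] have equal [p]-th powers modulo [p ^+ 2]. This forces
    the values of a Frobenius lift on [p]-th powers, and it makes the Frobenius pullbacks
    cofinal. *)

Section Divides.
Variables (A : comNzRingType) (u : A).

Definition dvds : {pred A} := [pred x | `[< exists y, x = u * y >]].

Lemma dvdsP x : reflect (exists y, x = u * y) (x \in dvds).
Proof. exact: asboolP. Qed.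

Fact dvds_zmod_closed : zmod_closed dvds.
Proof.
split=> [|x y /dvdsP[a ->] /dvdsP[b ->]]; apply/dvdsP; first by exists 0; rewrite mulr0.
by exists (a - b); rewrite mulrBr.
Qed.
HB.instance Definition _ := GRing.isZmodClosed.Build A dvds dvds_zmod_closed.

Lemma dvds_mull x : u * x \in dvds.
Proof. by apply/dvdsP; exists x. Qed.

Lemma dvdsM a x : x \in dvds -> a * x \in dvds.
Proof. by move=> /dvdsP[y ->]; rewrite mulrCA dvds_mull. Qed.

Lemma dvdsMl a x : x \in dvds -> x * a \in dvds.
Proof. by rewrite mulrC; apply: dvdsM. Qed.

Lemma dvds_trans y x z : x - y \in dvds -> y - z \in dvds -> x - z \in dvds.
Proof. by move=> xy yz; rewrite -(subrKA y) rpredD. Qed.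

Lemma dvds_sym x y : (x - y \in dvds) = (y - x \in dvds).
Proof. by rewrite -opprB rpredN. Qed.

Lemma dvds_congr x y : x - y \in dvds -> (x \in dvds) = (y \in dvds).
Proof. by move=> xy; rewrite -[in RHS](rpredDr y xy) addrC subrK. Qed.

Lemma dvds_congrM x y z t :
  x - y \in dvds -> z - t \in dvds -> x * z - y * t \in dvds.
Proof.
move=> xy zt; have -> : x * z - y * t = z * (x - y) + y * (z - t) by ring.
by rewrite rpredD // dvdsM.
Qed.

Lemma dvds_congrX x y k : x - y \in dvds -> x ^+ k - y ^+ k \in dvds.
Proof. by move=> xy; rewrite subrXX dvdsMl. Qed.

Lemma dvds_congr_prod (J : finType) (P : pred J) (F G : J -> A) :
  (forall j, P j -> F j - G j \in dvds) ->
  \prod_(j | P j) F j - \prod_(j | P j) G j \in dvds.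
Proof.
move=> FG; apply: (big_ind2 (fun x y => x - y \in dvds)) => //.
  by rewrite subrr rpred0.
by move=> *; apply: dvds_congrM.
Qed.

End Divides.

(** * Koszul differentials and liftable cocycles *)

Section KoszulDifferential.
Variables (A : comNzRingType) (N : nat).
Implicit Types (u v : 'I_N -> A) (m : {set 'I_N} -> A) (T W : {set 'I_N}).

Definition pos T (j : 'I_N) : nat := #|[set l in T | (l < j)%N]|.

(** Cochains are plain functions on sets, so that cochains for different sequences [u] (powers, or
    sequences congruent modulo [p]) share one type; degrees enter only through conditions on
    [#|T|]. *)
Definition kd u m T : A := \sum_(j in T) (-1) ^+ pos T j * (u j * m (T :\ j)).

Lemma kd_eq u v m m' T :
  (forall j, j \in T -> u j = v j) -> (forall j, j \in T -> m (T :\ j) = m' (T :\ j)) ->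
  kd u m T = kd v m' T.
Proof. by move=> uv mm; apply: eq_bigr => j jT; rewrite uv // mm. Qed.

Lemma kdD u m m' T : kd u (fun S => m S + m' S) T = kd u m T + kd u m' T.
Proof. by rewrite -big_split; apply: eq_bigr => j _; rewrite !mulrDr. Qed.

Lemma kdZ u a m T : kd u (fun S => a * m S) T = a * kd u m T.
Proof. by rewrite mulr_sumr; apply: eq_bigr => j _; ring. Qed.

Lemma kdB u m m' T : kd u (fun S => m S - m' S) T = kd u m T - kd u m' T.
Proof. by rewrite -sumrB; apply: eq_bigr => j _; rewrite !mulrBr. Qed.

Lemma kd_sum (J : finType) (P : pred J) u (m : J -> {set 'I_N} -> A) T :
  kd u (fun S => \sum_(l | P l) m l S) T = \sum_(l | P l) kd u (m l) T.
Proof. by rewrite exchange_big; apply: eq_bigr => j _; rewrite !mulr_sumr. Qed.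

Lemma koszul_diffE u (c : koszul u A^o) T :
  (diff (koszul u A^o) c : cube_cochain (Cube (@koszul_edge_comp A N u A^o))) T =
  kd u (c : cube_cochain (Cube (@koszul_edge_comp A N u A^o))) T.
Proof.
rewrite ffunE; apply: eq_bigr => j jT; rewrite [edge _ _ _]koszul_edgeD1 //.
by rewrite -mulrzl rmorphXn rmorphN1.
Qed.

Lemma kd_kd u m T : kd u (kd u m) T = 0.
Proof.
pose c : cube_cochain (Cube (@koszul_edge_comp A N u A^o)) := [ffun S => m S : A^o].
have := congr1 (fun c' : cube_cochain _ => c' T) (diff_diff (c : koszul u A^o)).
rewrite cube0 => <-; rewrite koszul_diffE; apply: kd_eq => // j _.
rewrite koszul_diffE; apply: kd_eq => // l _; by rewrite ffunE.
Qed.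

Lemma dvds_kd_congr (p : A) u v m m' T :
  (forall j, j \in T -> u j - v j \in dvds p) ->
  (forall j, j \in T -> m (T :\ j) - m' (T :\ j) \in dvds p) ->
  kd u m T - kd v m' T \in dvds p.
Proof.
move=> uv mm; rewrite -sumrB; apply: rpred_sum => j jT.
by rewrite -mulrBr dvdsM // dvds_congrM // (uv, mm).
Qed.

Definition upow u (a : nat) := fun j : 'I_N => u j ^+ a.

Definition shift_exp u b m T := gprod u T ^+ b * m T.

(* Multiplication by [gprod u ^+ b] is the transition map of the direct system *)
(* of Koszul complexes on powers of [u] whose limit is the Cech complex.      *)
Lemma kd_shift u a b m T :
  kd (upow u (a + b)) (shift_exp u b m) T = gprod u T ^+ b * kd (upow u a) m T.
Proof.
rewrite mulr_sumr; apply: eq_bigr => j jT.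
have -> : gprod u T = u j * gprod u (T :\ j) by rewrite /gprod (big_setD1 j).
by rewrite /shift_exp /upow exprMn exprD; ring.
Qed.

Variable h : 'I_N.

Definition slice m T := (-1) ^+ pos T h * m (h |: T).

(** The mapping cone structure: a cochain is the pair of its values on sets avoiding [h] and of its
    [slice], and the two interact through multiplication by [u h]. *)
Lemma kd_slice u m T : h \notin T ->
  kd u m (h |: T) = (-1) ^+ pos T h * (u h * m T - kd u (slice m) T).
Proof.
move=> hT; rewrite /kd (big_setD1 h) ?finset.setU11 //= finset.setU1K //.
have -> : pos (h |: T) h = pos T h.
  by apply: eq_card => l; rewrite !inE; case: eqP => [->|//]; rewrite ltnn !andbF.
rewrite mulrBr; congr (_ + _); rewrite mulr_sumr -sumrN; apply: eq_bigr => j jT.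
have jh : j != h by apply: contraNneq hT => <-.
have -> : (h |: T) :\ j = h |: (T :\ j).
  by apply/setP => l; rewrite !inE; case: (l =P h) => [->|]; rewrite ?andbT // eq_sym.
have -> : pos (h |: T) j = ((h < j) + pos T j)%N.
  rewrite /pos (cardsD1 h) !inE eqxx /=; congr (_ + _)%N.
  apply: eq_card => l; rewrite !inE; case: (l =P h) => [->|] //=.
  by rewrite (negPf hT).
have -> : pos T h = ((j < h) + pos (T :\ j) h)%N.
  rewrite /pos (cardsD1 j) !inE jT /=; congr (_ + _)%N.
  by apply: eq_card => l; rewrite !inE andbA.
rewrite /slice !exprD.
(* As [j != h], exactly one of [h < j] and [j < h] holds, so the two signs are opposite. *)
have -> : (-1) ^+ (h < j)%N = - (-1) ^+ (j < h)%N :> A.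
  by move: jh; rewrite -(inj_eq val_inj) neq_ltn => /orP[] jh; rewrite jh ltnNge ltnW // ?opprK.
set s := (-1) ^+ pos (T :\ j) h; set e := (-1) ^+ (j < h)%N.
have s2 : s * s = 1 by rewrite -expr2 sqrr_sign.
(* The two sides agree only modulo [s * s = 1], so this factor is inserted before calling [ring]. *)
rewrite -[LHS]mulr1 -[X in _ * X = _]s2; ring.
Qed.

(* [slice m] is a homotopy between multiplication by [u h] and zero.         *)
Lemma kd_homotopy (p : A) u m T :
  (h \notin T -> kd u m (h |: T) \in dvds p) ->
  u h * m T - kd u (fun S => if h \in S then 0 else slice m S) T \in dvds p.
Proof.
case: (boolP (h \in T)) => hT; last first.
  move=> /(_ isT); rewrite kd_slice // => /(dvdsM ((-1) ^+ pos T h)).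
  rewrite signrMK.
  have -> // : kd u (fun S => if h \in S then 0 else slice m S) T = kd u (slice m) T.
  by apply: kd_eq => // j _; rewrite !inE (negPf hT) andbF.
have [T' hT' ->] : exists2 T' : {set 'I_N}, h \notin T' & T = h |: T'.
  by exists (T :\ h); [rewrite finset.setD11|rewrite finset.setD1K].
move=> _; rewrite kd_slice // ifN // [kd _ _ _]big1 ?subr0; last first.
  by move=> j _; rewrite /slice finset.setU11 !mulr0.
by rewrite /slice mulrCA signrMK subrr rpred0.
Qed.

(** The cone cochain assembled from its two components: [m] off [h], and [s] as its [slice] at
    [h]. *)
Definition extend m s T :=
  if h \in T then (-1) ^+ pos (T :\ h) h * s (T :\ h) else m T.

Lemma extend_in m s T : h \notin T -> extend m s (h |: T) = (-1) ^+ pos T h * s T.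
Proof. by move=> hT; rewrite /extend finset.setU11 finset.setU1K. Qed.

Lemma extend_out m s T : h \notin T -> extend m s T = m T.
Proof. by rewrite /extend => /negPf ->. Qed.

Lemma kd_extend_in u m s T : h \notin T ->
  kd u (extend m s) (h |: T) = (-1) ^+ pos T h * (u h * m T - kd u s T).
Proof.
move=> hT; rewrite kd_slice // extend_out //; congr (_ * (_ - _)).
apply: kd_eq => // j _; rewrite /slice extend_in ?signrMK //.
by rewrite !inE (negPf hT) andbF.
Qed.

Lemma kd_extend_out u m s T : h \notin T -> kd u (extend m s) T = kd u m T.
Proof.
move=> hT; apply: kd_eq => // j _; rewrite extend_out //.
by rewrite !inE (negPf hT) andbF.
Qed.

Lemma subsetU1_cases W T : h \notin W -> T \subset h |: W ->
  (T \subset W /\ h \notin T) \/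
  exists T', [/\ T' \subset W, h \notin T', T = h |: T' & #|T|%:Z = #|T'|%:Z + 1].
Proof.
move=> hW TW; have [hT|hT] := boolP (h \in T); [right|left]; last first.
  split=> //; apply/fintype.subsetP => l lT; have := fintype.subsetP TW l lT.
  by rewrite !inE => /orP[/eqP lh|//]; rewrite -lh lT in hT.
exists (T :\ h); rewrite finset.setD1K //; split=> //.
- apply/fintype.subsetP => l; rewrite !inE => /andP[lh lT].
  by have := fintype.subsetP TW l lT; rewrite !inE (negPf lh).
- by rewrite finset.setD11.
- by rewrite (cardsD1 h T) hT PoszD addrC.
Qed.

End KoszulDifferential.

Lemma dvds_choice (A : comNzRingType) (p : A) (J : Type) (P : J -> Prop) (F : J -> A) :
  (forall j, P j -> F j \in dvds p) -> exists e, forall j, P j -> F j = p * e j.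
Proof.
move=> FP; have /choice[e eP] j : exists y, P j -> F j = p * y.
  by case: (pselect (P j)) => [/FP/dvdsP[y ->]|]; [exists y|exists 0].
by exists e.
Qed.

Section Liftable.
Variables (A : comNzRingType) (N : nat) (p : A) (u : 'I_N -> A).
Implicit Types (m : {set 'I_N} -> A) (T W : {set 'I_N}) (n : int).

Definition span_mod W (x : A) : Prop :=
  exists r : 'I_N -> A, x - \sum_(j in W) r j * u j \in dvds p.

Lemma span_mod_dvds W x : x \in dvds p -> span_mod W x.
Proof. by move=> xp; exists (fun=> 0); rewrite big1 ?subr0 // => j; rewrite mul0r. Qed.

Lemma span_modD W x y : span_mod W x -> span_mod W y -> span_mod W (x + y).
Proof.
move=> [r xr] [s ys]; exists (fun j => r j + s j).
rewrite (eq_bigr _ (fun j _ => mulrDl _ _ _)) big_split /= opprD addrACA.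
exact: rpredD.
Qed.

Lemma span_modM W a x : span_mod W x -> span_mod W (a * x).
Proof.
move=> [r xr]; exists (fun j => a * r j).
by rewrite (eq_bigr _ (fun j _ => esym (mulrA _ _ _))) -mulr_sumr -mulrBr dvdsM.
Qed.

Lemma span_mod_gen W j : j \in W -> span_mod W (u j).
Proof.
move=> jW; exists (fun l => (l == j)%:R); rewrite (bigD1 j) //= eqxx mul1r big1.
  by rewrite addr0 subrr rpred0.
by move=> l /andP[_ /negPf ->]; rewrite mul0r.
Qed.

End Liftable.

(** * Radicals modulo [p] and annihilation of Koszul cohomology *)

Section Radical.
Variables (A : comNzRingType) (N : nat) (p : A) (u : 'I_N -> A).
Implicit Types (m : {set 'I_N} -> A) (T W : {set 'I_N}) (n : int).

(** Elements having a power in the span of [p] and the [u j ^+ a] are closed under sums, and they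
    include the multiples of [p] and every [r j * u j]; hence [x ^+ c] is one of them. *)
Lemma span_mod_upow W x c a : span_mod p u W (x ^+ c) ->
  exists c', span_mod p (upow u a) W (x ^+ c').
Proof.
move=> [r xr]; pose K := span_mod p (upow u a) W.
have radD y z : (exists c, K (y ^+ c)) -> (exists c, K (z ^+ c)) ->
    exists c, K ((y + z) ^+ c).
  move=> [k yk] [l zl]; exists (k + l)%N; rewrite exprDn.
  apply: (big_ind K) => [|* |i _]; [exact/span_mod_dvds/rpred0|exact: span_modD|].
  rewrite -mulr_natl; apply: span_modM.
  (* In each binomial term either the exponent [i] of [z] is at least [l], or the exponent
     [k + l - i] of [y] is at least [k]. *)
  have [li|li] := leqP l i.
    by rewrite -[X in z ^+ X](subnK li) exprD mulrA; apply: span_modM zl.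
  have -> : (k + l - i = (l - i) + k)%N by lia.
  by rewrite exprD mulrAC; apply: span_modM yk.
have [c' xc'] : exists c', K ((x ^+ c) ^+ c').
  rewrite -(subrK (\sum_(j in W) r j * u j) (x ^+ c)); apply: (radD).
    by exists 1%N; apply: span_mod_dvds.
  apply: (big_ind (fun y => exists c, K (y ^+ c))) => [||j jW]; last 1 first.
  - by exists a; rewrite exprMn; apply/span_modM/(span_mod_gen _ (upow u a)).
  - by exists 1%N; apply/span_mod_dvds/rpred0.
  - exact: radD.
by exists (c * c')%N; rewrite exprM.
Qed.

(** The ideal of a sequence kills its Koszul cohomology: the homotopies for the single elements are
    added with the weights [r j]. *)
Lemma span_mod_kills W n x m : span_mod p u W x ->
  (forall T, T \subset W -> #|T|%:Z = n + 1 -> kd u m T \in dvds p) ->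
  exists v, forall T, T \subset W -> #|T|%:Z = n -> x * m T - kd u v T \in dvds p.
Proof.
move=> [r xr] dm.
exists (fun T => \sum_(j in W) r j * (if j \in T then 0 else slice j m T)) => T TW Tn.
rewrite kd_sum (eq_bigr _ (fun j _ => kdZ _ _ _ _)).
apply: dvds_trans (_ : _ - (\sum_(j in W) r j * u j) * m T \in _) _.
  by rewrite -mulrBl dvdsMl.
rewrite mulr_suml -sumrB; apply: rpred_sum => j jW.
rewrite -mulrA -mulrBr dvdsM // kd_homotopy // => jT.
by rewrite dm ?finset.subUset ?finset.sub1set ?jW // cardsU1 jT PoszD Tn addrC.
Qed.

End Radical.

(** * Removing or adjoining one element of the radical *)

Section Transfer.
Variables (A : comNzRingType) (N : nat) (p : A) (u : 'I_N -> A).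
Implicit Types (m : {set 'I_N} -> A) (T W : {set 'I_N}) (n : int).

(* The cochain [m / gprod u ^+ a] of the Cech complex on the elements [u j],  *)
(* [j \in W], is a cocycle modulo [p] iff [kd (upow u a) m] vanishes modulo   *)
(* [p] after a [shift_exp].                                                   *)
Definition liftable W n := forall a, exists b, forall m,
  (forall T, T \subset W -> #|T|%:Z = n + 1 -> kd (upow u a) m T \in dvds p) ->
  exists2 m',
    forall T, T \subset W -> #|T|%:Z = n -> m' T - shift_exp u b m T \in dvds p &
    forall T, T \subset W -> #|T|%:Z = n + 1 -> kd (upow u (a + b)) m' T \in dvds (p ^+ 2).

Variables (W : {set 'I_N}) (h : 'I_N) (n : int).
Hypothesis hW : h \notin W.

(* A cocycle [m] on [W] extends to [h |: W]: the class of [m] becomes zero    *)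
(* after inverting [u h].                                                     *)
Lemma liftable_restrict c0 : span_mod p u W (u h ^+ c0) ->
  liftable (h |: W) n -> liftable W n.
Proof.
move=> uhW lift a; have [c uhc] := span_mod_upow a uhW.
have [b liftb] := lift (a + c)%N; exists (c + b)%N => m dm.
have [v mv] := span_mod_kills uhc dm.
have hN T : T \subset W -> h \notin T.
  by move=> TW; apply: contra hW; apply: (fintype.subsetP TW).
have WU T : T \subset W -> T \subset h |: W.
  by move=> TW; rewrite (fintype.subset_trans TW) // finset.subsetUr.
(* Multiplying the congruence of [u h ^+ c * m] with [kd (upow u a) v] by
   [gprod u T ^+ c * u h ^+ a] says exactly that [m], shifted by [c] and extended by [s], is a
   cocycle modulo [p] for the exponent [a + c]. *)
pose s T := gprod u T ^+ c * (u h ^+ a * v T).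
have [T TW Tn|M' M'M dM'] := liftb (extend h (shift_exp u c m) s).
  case: (subsetU1_cases hW TW) => [[TW' hT]|[T' [T'W hT' eT cT]]].
    by rewrite kd_extend_out // kd_shift dvdsM // dm.
  rewrite eT kd_extend_in // dvdsM // kd_shift kdZ /upow exprD /shift_exp.
  have -> : forall x y z t r : A, x * y * (z * t) - z * (x * r) = z * x * (y * t - r).
    by move=> *; ring.
  by rewrite dvdsM // mv //; apply: (@addIr _ 1); rewrite -Tn.
exists M' => T TW Tn; last by rewrite addnA dM' // WU.
have := M'M T; rewrite /shift_exp extend_out ?hN ?WU // => /(_ isT Tn).
by rewrite mulrA -exprD addnC.
Qed.

(** The part of [m] on [W] lifts to some [M]. The obstruction to lifting the slice compatibly is a
    cocycle [e] modulo [p]; a power of [u h] makes it a coboundary, and a primitive [v] corrects the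
    slice by [p * v]. *)
Lemma liftable_extend c0 : nonzerodivisor p -> span_mod p u W (u h ^+ c0) ->
  liftable W n -> liftable (h |: W) n.
Proof.
move=> p_reg uhW lift a; have [b liftb] := lift a.
have [c uhc] := span_mod_upow (a + b) uhW; exists (b + c)%N => m dm.
have hN T : T \subset W -> h \notin T.
  by move=> TW; apply: contra hW; apply: (fintype.subsetP TW).
have WU T : T \subset W -> T \subset h |: W.
  by move=> TW; rewrite (fintype.subset_trans TW) // finset.subsetUr.
have WhU T : T \subset W -> h |: T \subset h |: W by move=> TW; rewrite finset.setUS.
have card1 T : T \subset W -> #|T|%:Z = n -> #|h |: T|%:Z = n + 1.
  by move=> TW <-; rewrite cardsU1 hN // PoszD addrC.
have [T TW Tn|M Mm dM] := liftb m; first by rewrite dm // WU.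
(* The extra [u h ^+ b] comes from [gprod u (h |: T) = u h * gprod u T]: the slice takes its values
   at [h |: T]. *)
pose s T := shift_exp u b (fun T => u h ^+ b * slice h m T) T.
have sE T : kd (upow u (a + b)) s T = gprod u T ^+ b * (u h ^+ b * kd (upow u a) (slice h m) T).
  by rewrite kd_shift kdZ.
have [e eP] : exists e, forall T, T \subset W /\ #|T|%:Z = n ->
    u h ^+ (a + b) * M T - kd (upow u (a + b)) s T = p * e T.
  apply: dvds_choice => T [TW Tn]; rewrite sE.
  apply: dvds_trans (_ : _ - u h ^+ (a + b) * shift_exp u b m T \in _) _.
    by rewrite -mulrBr dvdsM // Mm.
  have := dm _ (WhU _ TW) (card1 _ TW Tn); rewrite kd_slice ?hN // => dm'.
  rewrite /shift_exp exprD.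
  have -> : forall x y z t r : A, x * y * (z * t) - z * (y * r) = z * y * (x * t - r).
    by move=> *; ring.
  by rewrite dvdsM // -[_ - _](signrMK (pos T h)) dvdsM.
(* Here [e] is a cocycle modulo [p]: by [eP], [p] times its differential is [u h ^+ (a + b)] times
   that of [M], which is divisible by [p ^+ 2], and one factor [p] cancels. *)
have [T TW Tn|v ev] := span_mod_kills uhc (m := e) (n := n).
  apply/dvdsP; have /dvdsP[x ex] := dM T TW Tn; exists (u h ^+ (a + b) * x).
  apply: subr0_eq; apply: p_reg; rewrite mulrBr -kdZ.
  rewrite (kd_eq (v := upow u (a + b)) (m' := fun T => u h ^+ (a + b) * M T -
    kd (upow u (a + b)) s T)) // => [|j jT].
    by rewrite kdB kd_kd kdZ ex; ring.
  rewrite eP //; split; first by rewrite (fintype.subset_trans (finset.subD1set _ _)).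
  by apply: (@addIr _ 1); rewrite -Tn (cardsD1 j T) jT PoszD addrC.
exists (extend h (shift_exp u c M) (shift_exp u c (fun T => u h ^+ c * s T + p * v T)))
    => T /(subsetU1_cases hW)[[TW hT] Tn|[T' [T'W hT' eT cT]] Tn].
- rewrite extend_out // /shift_exp exprD [_ ^+ b * _]mulrC -mulrA -mulrBr dvdsM //.
  exact: Mm.
- rewrite eT extend_in // /shift_exp /s /slice /shift_exp.
  have -> : gprod u (h |: T') = u h * gprod u T' by rewrite /gprod big_setU1.
  apply/dvdsP; exists ((-1) ^+ pos T' h * gprod u T' ^+ c * v T').
  rewrite -[m _ in X in _ - X](signrMK (pos T' h)) !exprMn !exprD; ring.
- by rewrite addnA kd_extend_out // kd_shift dvdsM // dM.
rewrite addnA eT kd_extend_in // kd_shift kdD !kdZ dvdsM // /upow exprD /shift_exp.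
have {cT Tn} T'n : #|T'|%:Z = n by apply: (@addIr _ 1); rewrite -Tn.
have := ev T' T'W T'n => /dvdsP[x ex].
apply/dvdsP; exists (gprod u T' ^+ c * x).
have eT' := eP T' (conj T'W T'n).
transitivity (gprod u T' ^+ c * (u h ^+ c * (u h ^+ (a + b) * M T' - kd (upow u (a + b)) s T')
   - p * kd (upow u (a + b)) v T')); first by ring.
by rewrite eT' mulrCA -mulrBr ex; ring.
Qed.

End Transfer.

(** * Order-preserving changes of the index set *)

Section Reindex.
Variables (A : comNzRingType) (p : A) (k N : nat) (iota : 'I_k -> 'I_N) (u : 'I_N -> A).
Hypothesis iota_lt : forall i j : 'I_k, (iota i < iota j)%N = (i < j)%N.
Implicit Types (T : {set 'I_k}).

Lemma mono_inj : injective iota.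
Proof.
move=> i j ij; apply: val_inj => /=.
by case: (ltngtP i j) => // lt; have := iota_lt i j; have := iota_lt j i;
  rewrite lt ij ltnn.
Qed.

Lemma imset_mono_eq T : iota @^-1: (iota @: T) = T.
Proof. by apply/setP => j; rewrite inE mem_imset //; apply: mono_inj. Qed.

(** Monotonicity of [iota] keeps the positions [pos], hence the signs. *)
Lemma kd_imset (v : 'I_N -> A) m T : kd v m (iota @: T) = kd (v \o iota) (fun S => m (iota @: S)) T.
Proof.
rewrite /kd big_imset /=; last by move=> i j _ _; apply: mono_inj.
apply: eq_bigr => j jT; congr (_ ^+ _ * (_ * m _)).
  rewrite /pos -(card_imset [set l in T | (l < j)%N] mono_inj); apply: eq_card => l.
  rewrite inE; apply/andP/imsetP => [[/imsetP[i iT ->]]|[i]].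
    by rewrite iota_lt => ij; exists i; rewrite ?inE ?iT.
  by rewrite inE => /andP[iT ij] ->; rewrite imset_f // iota_lt.
apply/setP => l; rewrite !inE; apply/andP/imsetP => [[lj /imsetP[i iT e]]|[i]].
  by exists i; rewrite // !inE iT andbT; apply: contraNneq lj => <-; rewrite e.
by rewrite !inE => /andP[ij iT] ->; rewrite (inj_eq mono_inj) ij imset_f.
Qed.

Lemma gprod_imset T : gprod u (iota @: T) = gprod (u \o iota) T.
Proof. by rewrite /gprod big_imset //= => i j _ _; apply: mono_inj. Qed.

Lemma liftable_imset n :
  liftable p u (iota @: finset.setT) n <-> liftable p (u \o iota) finset.setT n.
Proof.
have cardE T : #|iota @: T| = #|T| by rewrite card_imset //; apply: mono_inj.
have imW (T' : {set 'I_N}) : T' \subset iota @: finset.setT -> exists T, T' = iota @: T.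
  move=> T'W; exists (iota @^-1: T'); apply/setP => l.
  apply/idP/imsetP => [lT'|[i]]; last by rewrite inE => ? ->.
  by have /imsetP[i _ li] := fintype.subsetP T'W l lT'; exists i; rewrite // inE -li.
have kdE (v : 'I_N -> A) m T : kd (v \o iota) m T = kd v (fun S => m (iota @^-1: S)) (iota @: T).
  by rewrite kd_imset; apply: kd_eq => // j _; rewrite imset_mono_eq.
split=> lift a; have [b liftb] := lift a; exists b => m dm.
  have [_ /imW[T ->]|M Mm dM] := liftb (fun S => m (iota @^-1: S)).
    by rewrite cardE => Tn; rewrite -kdE -[_ \o iota]/(upow (u \o iota) a) dm ?finset.subsetT.
  exists (fun S : {set 'I_k} => M (iota @: S)) => T _ Tn.
    have := Mm (iota @: T); rewrite cardE imsetS ?finset.subsetT // => /(_ isT Tn).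
    by rewrite /shift_exp imset_mono_eq gprod_imset.
  have := dM (iota @: T); rewrite cardE imsetS ?finset.subsetT // => /(_ isT Tn).
  by rewrite kd_imset.
have [T _ Tn|M Mm dM] := liftb (fun S => m (iota @: S)).
  by rewrite -[upow _ _]/(upow u a \o iota) -kd_imset dm ?cardE // imsetS ?finset.subsetT.
exists (fun S : {set 'I_N} => M (iota @^-1: S)) => _ /imW[T ->]; rewrite cardE => Tn.
  by rewrite /shift_exp imset_mono_eq gprod_imset; apply: Mm; rewrite ?finset.subsetT.
by rewrite -kdE -[_ \o iota]/(upow (u \o iota) (a + b)) dM ?finset.subsetT.
Qed.

Lemma span_mod_imset x : span_mod p (u \o iota) finset.setT x -> span_mod p u (iota @: finset.setT) x.
Proof.
move=> [r xr].
exists (fun j => \sum_(i | iota i == j) r i); rewrite big_imset /=; last first.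
  by move=> i j _ _; apply: mono_inj.
rewrite (eq_bigr (fun j => r j * (u \o iota) j)) // => j _; congr (_ * _).
by rewrite (big_pred1 j) // => i; rewrite /= (inj_eq mono_inj).
Qed.

End Reindex.

(** * Independence of the generators, up to radicals modulo [p] *)

Section ChangeOfGenerators.
Variables (A : comNzRingType) (p : A) (n : int).
Hypothesis p_reg : nonzerodivisor p.

Lemma span_mod_subset N (u : 'I_N -> A) (W W' : {set 'I_N}) x :
  W \subset W' -> span_mod p u W x -> span_mod p u W' x.
Proof.
move=> WW' [r xr]; exists (fun j => if j \in W then r j else 0).
rewrite (_ : \sum_(j in W') _ = \sum_(j in W) r j * u j) //.
rewrite (big_setID W) /= (finset.setIidPr WW') [in RHS](eq_bigr (fun j => (if j \in W then r j else 0) * u j)).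
  by rewrite [X in _ + X]big1 ?addr0 // => j; rewrite inE => /andP[/negPf -> _]; rewrite mul0r.
by move=> j ->.
Qed.

Lemma liftable_setU N (u : 'I_N -> A) (U W : {set 'I_N}) :
  (forall j, j \in U -> exists c, span_mod p u W (u j ^+ c)) ->
  liftable p u (U :|: W) n <-> liftable p u W n.
Proof.
rewrite -[U]set_enum; elim: (enum U) => [|j s IHs] radW.
  by rewrite (_ : _ :|: W = W) //; apply/setP => l; rewrite !inE.
rewrite set_cons -finset.setUA.
have {IHs} <- : liftable p u ([set l in s] :|: W) n <-> liftable p u W n.
  by apply: IHs => l ls; apply: radW; rewrite !inE in ls *; rewrite ls orbT.
have [jW|jW] := boolP (j \in [set l in s] :|: W).
  by rewrite (_ : j |: _ = [set l in s] :|: W) //; apply/finset.setUidPr; rewrite finset.sub1set.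
have [c jc] : exists c, span_mod p u W (u j ^+ c).
  by apply: radW; rewrite !inE eqxx.
have {}jc := span_mod_subset (finset.subsetUr [set l in s] W) jc.
by split; [apply: liftable_restrict jc|apply: liftable_extend jc].
Qed.

(** Both sequences are compared with their concatenation [u], which enlarges each of them only by
    elements of its radical modulo [p]. *)
Lemma liftable_radical (k t : nat) (g : 'I_k -> A) (f : 'I_t -> A) :
  (forall j, exists c, span_mod p g finset.setT (f j ^+ c)) ->
  (forall j, exists c, span_mod p f finset.setT (g j ^+ c)) ->
  liftable p f finset.setT n -> liftable p g finset.setT n.
Proof.
move=> fg gf.
pose u i := match fintype.split i with inl l => g l | inr j => f j end.
have ug : u \o lshift t = g.
  by apply/funext => l; rewrite /u /= -[lshift t l]/(unsplit (inl l)) unsplitK.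
have uf : u \o @rshift k t = f.
  by apply/funext => l; rewrite /u /= -[rshift k l]/(unsplit (inr l)) unsplitK.
have lt_l (i j : 'I_k) : (lshift t i < lshift t j)%N = (i < j)%N by [].
have lt_r (i j : 'I_t) : (rshift k i < rshift k j)%N = (i < j)%N by rewrite ltn_add2l.
pose Wg := lshift t @: [set: 'I_k]; pose Wf := @rshift k t @: [set: 'I_t].
have radg j : j \in Wf -> exists c, span_mod p u Wg (u j ^+ c).
  move=> /imsetP[l _ ->]; have [c lc] := fg l; exists c.
  by apply: span_mod_imset => //; rewrite -[u _]/((u \o _) l) uf ug.
have radf j : j \in Wg -> exists c, span_mod p u Wf (u j ^+ c).
  move=> /imsetP[l _ ->]; have [c lc] := gf l; exists c.
  by apply: span_mod_imset => //; rewrite -[u _]/((u \o _) l) uf ug.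
rewrite -{1}uf -{1}ug -!liftable_imset // -(liftable_setU radf) -(liftable_setU radg).
by rewrite finset.setUC.
Qed.

End ChangeOfGenerators.

(** * Cech cohomology and the Bockstein homomorphism *)

Section CechCochains.
Variables (A : comNzRingType) (k : nat) (g : 'I_k -> A).

Local Notation frac := Defs.frac.
Local Notation cochains M := (cube_cochain (cech_cube g M)).

Lemma frac_expand (M : lmodType A) s (m : M) a b : frac s m a = frac s (s ^+ b *: m) (a + b).
Proof. by apply/frac_eq; exists 0%N; rewrite !add0n scalerA -exprD addnC. Qed.

Lemma fracDr (M : lmodType A) s a : {morph (fun m : M => frac s m a) : x y / x + y}.
Proof.
move=> x y; rewrite fracD; apply/frac_eq; exists 0%N.
by rewrite -scalerDr scalerA -exprD !add0n.
Qed.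

Lemma frac0r (M : lmodType A) s a : frac s (0 : M) a = 0.
Proof. by apply/frac_eq0; exists 0%N; rewrite scaler0. Qed.

Lemma cech_cochain_frac (M : lmodType A) (c : cochains M) :
  exists (m : {set 'I_k} -> M) a, forall T, c T = frac (gprod g T) (m T) a.
Proof.
have /choice[x xP] (T : {set 'I_k}) : exists x : M * nat, c T = frac (gprod g T) x.1 x.2.
  by have [m [a ->]] := fracP (c T); exists (m, a).
pose a := \max_T (x T).2.
exists (fun T => gprod g T ^+ (a - (x T).2) *: (x T).1), a => T.
by rewrite xP (frac_expand _ _ _ (a - (x T).2)) subnKC // leq_bigmax.
Qed.

Lemma cech_diff_frac (c : cochains A^o) (m : {set 'I_k} -> A) a T :
  (forall S, c S = frac (gprod g S) (m S : A^o) a) ->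
  cube_diff c T = frac (gprod g T) (kd (upow g a) m T : A^o) a.
Proof.
move=> cE; rewrite ffunE (big_morph _ (fracDr (gprod g T) a) (frac0r _ _ _)).
apply: eq_bigr => j jT; rewrite cE /= modloc_widenE -signr_odd -[in RHS]signr_odd.
have -> : gprod g (T :\: (T :\ j)) = g j.
  rewrite /gprod (big_pred1 j) // => l.
  by rewrite !inE; case: eqP => [->|_]; rewrite ?jT //=; case: (l \in T).
case: (odd _); last by rewrite !expr0 mulr1z mul1r.
by rewrite !expr1 mulN1r mulrN1z fracN.
Qed.

Variables (p : A) (n : int).
Hypothesis p_reg : nonzerodivisor p.

Lemma class0 (C : complex) i : class (0 : cocycle C i) = 0.
Proof. by rewrite /class raddf0. Qed.

(** A representative of [x] lifts to a cochain [c] with differential [p * w], and the Bockstein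
    image is the class of [w] modulo [p]. If, after a shift, [c + p * v] has differential
    [p ^+ 2 * y], cancelling [p] shows that [w] is minus the differential of [v] modulo [p]. *)
Lemma bockstein_eq0 : liftable p g finset.setT n ->
  forall x : loc_cohomology g (modquot p A^o) n, bockstein x = 0.
Proof.
move=> lift x; rewrite /bockstein.
have [z [c [w [_ ci cz wc <-]]]] := bockstein_deltaP x p_reg.
have [m0 [a0 c0E]] := cech_cochain_frac (c : cochains A^o).
have [w0 [a1 w0E]] := cech_cochain_frac (val w : cochains A^o).
have /choice[d dP] (T : {set 'I_k}) : exists d, gprod g T ^+ (d + a0) * (p * w0 T : A) =
    gprod g T ^+ (d + a1) * kd (upow g a0) m0 T.
  have := congr1 (fun f : cochains A^o => f T) wc.
  by rewrite /= (cech_diff_frac _ c0E) ffunE w0E modloc_funE => /frac_eq.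
(* With the exponent [D] the equalities of fractions [dP] hold in [A] at all vertices; over the
   common denominator exponent [e], the numerators of [c] and [w] become [shift_exp g (a1 + D) m0]
   and [w1]. *)
pose D := \max_T d T; pose e := (a0 + (a1 + D))%N.
pose w1 T : A := gprod g T ^+ (a0 + D) * w0 T.
have w1E T : kd (upow g e) (shift_exp g (a1 + D) m0) T = p * w1 T.
  have dD : (d T <= D)%N by apply: leq_bigmax.
  rewrite kd_shift /w1 mulrCA.
  have -> : (a1 + D = (D - d T) + (d T + a1))%N by lia.
  have -> : (a0 + D = (D - d T) + (d T + a0))%N by lia.
  by rewrite exprD -mulrA -dP mulrA -exprD.
have [b liftb] := lift e.
have [T _ Tn|M Mm dM] := liftb (shift_exp g (a1 + D) m0).
  by rewrite w1E dvds_mull.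
have [v vP] : exists v, forall T : {set 'I_k}, #|T|%:Z = n ->
    M T - shift_exp g b (shift_exp g (a1 + D) m0) T = p * v T.
  by apply: dvds_choice => T Tn; apply: Mm; rewrite ?finset.subsetT.
(* The value 0 outside degree [n] makes [B0] below homogeneous. *)
pose v1 (T : {set 'I_k}) := if #|T|%:Z == n then - v T else 0.
have v1P (T : {set 'I_k}) : #|T|%:Z = n + 1 ->
    gprod g T ^+ b * w1 T - kd (upow g (e + b)) v1 T \in dvds p.
  move=> Tn; have /dvdsP[y yE] := dM T (finset.subsetT T) Tn.
  apply/dvdsP; exists y; apply: subr0_eq; apply: p_reg.
  pose m := shift_exp g b (shift_exp g (a1 + D) m0).
  transitivity (kd (upow g (e + b)) (fun S => m S - p * v1 S - M S) T).
    by rewrite !kdB kdZ kd_shift w1E yE; ring.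
  apply: big1 => j jT.
  have Tn' : #|T :\ j|%:Z = n.
    by apply: (@addIr _ 1); rewrite -Tn (cardsD1 j T) jT PoszD addrC.
  by rewrite /v1 Tn' eqxx mulrN -vP // -/m opprK addrCA !subrr addr0 subrr !mulr0.
pose B0 : cochains A^o := [ffun T => frac (gprod g T) (v1 T : A^o) (e + b)].
have B0n : B0 \in degree (cech g A^o) (n + 1 - 1).
  rewrite addrK; apply/cube_homogP => T /negPf Tn.
  by rewrite ffunE /v1 Tn frac0r.
rewrite /bockstein_pi cohomology_mapE -class0; apply/class_eq.
exists (cech_map g (to_quot p (M := A^o)) B0); first exact: cmap_degree.
rewrite -cmap_diff [val 0]raddf0 subr0; apply/ffunP => T.
have [Tn|Tn] := eqVneq #|T|%:Z (n + 1); last first.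
  have := cocycleP w; rewrite inE => /andP[/(cmap_degree (cech_map g (to_quot p (M := A^o))))].
  move=> /cube_homogP -> // _.
  have := cmap_degree (cech_map g (to_quot p (M := A^o))) (diff_degree B0n).
  by rewrite addrAC addrK => /cube_homogP ->.
have dB0E : (diff (cech g A^o) B0 : cochains A^o) T =
    frac (gprod g T) (kd (upow g (e + b)) v1 T : A^o) (e + b).
  by apply: cech_diff_frac => S; rewrite ffunE.
rewrite [LHS]ffunE [RHS]ffunE dB0E w0E !modloc_funE.
have /dvdsP[y yE] := v1P T Tn.
rewrite (frac_expand _ _ a1 (a0 + D + b)).
have -> : (a1 + (a0 + D + b) = e + b)%N by rewrite /e; lia.
congr (frac _ _ _); rewrite -linearZ; apply/to_quot_eq; exists y.
by rewrite -[RHS]yE /w1 mulrA -exprD addnC.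
Qed.

End CechCochains.

(** * Lifting Koszul cocycles when cohomology has no [p]-torsion *)

Definition koszul_lifts (A : comNzRingType) (p : A) N (u : 'I_N -> A) (n : int) :=
  forall m, (forall T : {set 'I_N}, #|T|%:Z = n + 1 -> kd u m T \in dvds p) ->
  exists2 m',
    forall T : {set 'I_N}, #|T|%:Z = n -> m' T - m T \in dvds p &
    forall T : {set 'I_N}, #|T|%:Z = n + 1 -> kd u m' T \in dvds (p ^+ 2).

(** An integer outside [p Z] generates the unit ideal together with [p], so it cannot kill [x]; the
    annihilator of [x] is thus exactly [p Z]. *)
Lemma assZ_torsion (M : zmodType) p (x : M) : prime p -> x != 0 -> x *+ p = 0 -> assZ p M.
Proof.
move=> p_pr x0 xp; exists x => n; split=> [xn|/dvdzP[d ->]]; last first.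
  by rewrite mulrC mulrzA -pmulrn xp mul0rz.
apply: contraNT x0 => pn; have [a [b ab]] := Bezoutz n p.
have {}ab : a * n + b * p = 1.
  rewrite ab; apply/eqP; rewrite -[_ == _]/(coprimez n p) coprimezE coprime_sym.
  by rewrite prime_coprime // -dvdzE.
have -> : x = x *~ (n * a + p%:Z * b) by rewrite [n * a]mulrC [p%:Z * b]mulrC ab mulr1z.
by rewrite mulrzDr !mulrzA xn -pmulrn xp !mul0rz addr0.
Qed.

(** Write the differential of [m] as [p * w]. Since [p] is regular, [w] is a cocycle, and its class
    is killed by [p], hence zero. If [w] is the differential of [b], then [m - p * b] is the
    required lift. *)
Lemma koszul_lifts_torsionfree (A : comNzRingType) (p N : nat) (u : 'I_N -> A) n :
  prime p -> nonzerodivisor (p%:R : A) -> ~ assZ p (cohomology (koszul u A^o) (n + 1)) ->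
  koszul_lifts p%:R u n.
Proof.
move=> p_pr p_reg notass m dm.
have cardD1 (T : {set 'I_N}) j i : j \in T -> (#|T :\ j|%:Z == i) = (#|T|%:Z == i + 1).
  by move=> jT; rewrite (cardsD1 j T) jT PoszD addrC (inj_eq (addIr 1)).
have [w wE] : exists w, forall T : {set 'I_N}, #|T|%:Z = n + 1 -> kd u m T = p%:R * w T.
  by apply: dvds_choice.
(* Truncation to one degree turns the hypotheses into identities [dm1] and [dw1] valid on all sets,
   as genuine homogeneous cochains require. *)
pose m1 (T : {set 'I_N}) := if #|T|%:Z == n then m T else 0.
pose w1 (T : {set 'I_N}) := if #|T|%:Z == n + 1 then w T else 0.
have dm1 T : kd u m1 T = p%:R * w1 T.
  rewrite /w1; case: eqP => [Tn|/eqP Tn].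
    by rewrite -wE //; apply: kd_eq => // j jT; rewrite /m1 cardD1 // Tn eqxx.
  by rewrite mulr0; apply: big1 => j jT; rewrite /m1 cardD1 // (negPf Tn) !mulr0.
have dw1 T : kd u w1 T = 0.
  by apply: p_reg; rewrite -kdZ -[RHS](kd_kd u m1 T); apply: kd_eq => // j _; rewrite dm1.
pose C := koszul u A^o; pose ev (c : C) T :=
  (c : cube_cochain (Cube (@koszul_edge_comp A N u A^o))) T : A.
have evP (c c' : C) : (forall T, ev c T = ev c' T) -> c = c'.
  by move=> cc; apply/ffunP => T; apply: cc.
pose coc (v : {set 'I_N} -> A) : C :=
  [ffun T => v T : A^o] : cube_cochain (Cube (@koszul_edge_comp A N u A^o)).
have cocE v T : ev (coc v) T = v T by rewrite /ev ffunE.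
have diffE c T : ev (diff C c) T = kd u (ev c) T by rewrite /ev koszul_diffE.
have evM (c : C) k T : ev (c *+ k) T = ev c T *+ k.
  elim: k => [|k IHk]; first by rewrite !mulr0n /ev cube0.
  by rewrite !mulrS -IHk /ev cubeD.
have Wcocycle : coc w1 \in @is_cocycle C (n + 1).
  rewrite inE; apply/andP; split.
    by apply/cube_homogP => T /negPf Tn; rewrite -[LHS]/(ev _ _) cocE /w1 Tn.
  apply/eqP/evP => T; rewrite diffE (kd_eq (v := u) (m' := w1)) => [|//|j _]; last exact: cocE.
  by rewrite dw1 /ev cube0.
pose z := class (Cocycle Wcocycle).
have zp : z *+ p = 0.
  rewrite /z -class0 /class -raddfMn; apply/class_eq; exists (coc m1).
    by rewrite addrK; apply/cube_homogP => T /negPf Tn; rewrite -[LHS]/(ev _ _) cocE /m1 Tn.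
  rewrite [val 0]raddf0 subr0; apply: evP => T.
  rewrite diffE (kd_eq (v := u) (m' := m1)) => [|//|j _]; last exact: cocE.
  rewrite dm1.
  rewrite raddfMn evM mulr_natl; congr (_ *+ _); exact: cocE.
have [z0|z0] := eqVneq z 0; last by case: notass; apply: assZ_torsion zp.
move: z0; rewrite /z -class0 => /class_eq[b]; rewrite addrK => bn.
rewrite [val 0]raddf0 subr0 => Wb.
have w1b T : w1 T = kd u (ev b) T by rewrite -diffE -Wb cocE.
exists (fun T => m T - p%:R * ev b T) => T Tn; first by rewrite addrAC subrr sub0r rpredN dvds_mull.
by rewrite kdB kdZ -w1b wE // /w1 Tn eqxx subrr rpred0.
Qed.

(** * Lifting Frobenius modulo the square of p *)

Section Frobenius.
Variables (A : comNzRingType) (p : nat).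
Hypothesis p_pr : prime p.
Local Notation P := (p%:R : A).

(** Up to sign, the addition polynomial of Witt vectors of length 2:
    [(x, 0) + (y, 0) = (x + y, - carry x y)]. *)
Definition carry (x y : A) :=
  \sum_(i < p.-1) (x ^+ (p.-1 - i) * y ^+ i.+1) *+ ('C(p, i.+1) %/ p).

Lemma exprD_carry x y : (x + y) ^+ p = x ^+ p + y ^+ p + P * carry x y.
Proof.
have p_gt0 := prime_gt0 p_pr.
rewrite exprDn -(big_mkord xpredT (fun i => x ^+ (p - i) * y ^+ i *+ 'C(p, i))).
rewrite big_nat_recr //= big_ltn // big_add1 /= subn0 bin0 expr0 mulr1 mulr1n.
rewrite subnn binn expr0 mul1r mulr1n addrAC; congr (_ + _).
rewrite big_mkord mulr_sumr; apply: eq_bigr => i _; rewrite mulr_natl -mulrnA divnK.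
  by congr (_ ^+ _ * _ *+ _); lia.
by rewrite prime_dvd_bin //=; have := ltn_ord i; lia.
Qed.

Lemma frob_add x y : (x + y) ^+ p - (x ^+ p + y ^+ p) \in dvds P.
Proof. by rewrite exprD_carry addrAC subrr add0r dvds_mull. Qed.

Lemma expr0p : 0 ^+ p = 0 :> A.
Proof. by rewrite expr0n; case: p p_pr. Qed.

Lemma frob_sum (J : Type) (r : seq J) (Q : pred J) (F : J -> A) :
  (\sum_(j <- r | Q j) F j) ^+ p - \sum_(j <- r | Q j) F j ^+ p \in dvds P.
Proof.
apply: (big_ind2 (fun x y => x ^+ p - y \in dvds P)) => [|x x' y y' xx' yy'|j _].
- by rewrite expr0p subrr rpred0.
- apply: dvds_trans (frob_add x y) _; by rewrite opprD addrACA rpredD.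
- by rewrite subrr rpred0.
Qed.

Lemma frob_opp x : (- x) ^+ p - - x ^+ p \in dvds P.
Proof. by have := frob_add x (- x); rewrite subrr expr0p sub0r rpredN opprK addrC. Qed.

Lemma frob_sign k x : ((-1) ^+ k * x) ^+ p - (-1) ^+ k * x ^+ p \in dvds P.
Proof.
rewrite -signr_odd; case: (odd k); last by rewrite !expr0 !mul1r subrr rpred0.
by rewrite !expr1 !mulN1r frob_opp.
Qed.

Lemma frob_muln x k : (x *+ k) ^+ p - x ^+ p *+ k \in dvds P.
Proof.
by rewrite -(card_ord k) -!sumr_const; apply: frob_sum.
Qed.

(** The cofactor of [x - y] in [x ^+ p - y ^+ p] is a sum of [p] terms all congruent to [y ^+ p.-1],
    so it contributes a second factor [p]. *)
Lemma frob_congr x y : x - y \in dvds P -> x ^+ p - y ^+ p \in dvds (P ^+ 2).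
Proof.
move=> xy; rewrite subrXX; case/dvdsP: (xy) => a ->.
suff /dvdsP[b ->] : \sum_(i < p) x ^+ (p.-1 - i) * y ^+ i \in dvds P.
  by apply/dvdsP; exists (a * b); ring.
have -> : \sum_(i < p) x ^+ (p.-1 - i) * y ^+ i =
    P * y ^+ p.-1 + \sum_(i < p) (x ^+ (p.-1 - i) - y ^+ (p.-1 - i)) * y ^+ i.
  rewrite mulr_natl -[X in _ *+ X](card_ord p) -sumr_const -big_split.
  apply: eq_bigr => i _; rewrite /= mulrBl -exprD subnK; last by have := ltn_ord i; lia.
  by rewrite addrC subrK.
by rewrite rpredD ?dvds_mull ?rpred_sum // => i _; rewrite dvdsMl ?dvds_congrX.
Qed.

(** [carry] is a polynomial with integer coefficients, and these are fixed by Frobenius modulo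
    [p]. *)
Lemma carry_frob x y : carry (x ^+ p) (y ^+ p) - carry x y ^+ p \in dvds P.
Proof.
rewrite dvds_sym; apply: dvds_trans (frob_sum _ _ _) _.
rewrite -sumrB; apply: rpred_sum => i _; rewrite /= dvds_sym.
by rewrite -!exprM ![(p * _)%N]mulnC !exprM -exprMn dvds_sym frob_muln.
Qed.

End Frobenius.

(** * Residue fields and purely inseparable elements *)

Lemma quotient_ring (A : comNzRingType) (u : A) : 1 \notin dvds u ->
  exists (B : comNzRingType) (pi : {rmorphism A -> B}),
    (forall b, exists a, pi a = b) /\ forall a, pi a = 0 <-> a \in dvds u.
Proof.
move=> u1.
have idealI a : {in dvds u, forall x, a * x \in dvds u} by move=> x; apply: dvdsM.
pose I : idealr A := HB.pack (dvds u : A -> bool) (GRing.isZmodClosed.Build A (dvds u) (dvds_zmod_closed u))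
  (isProperIdeal.Build A (dvds u) (conj u1 idealI)).
exists {ideal_quot I}, (\pi_{ideal_quot I})%qT; split=> [b|a].
  by exists (repr b); exact: reprK.
split=> [/eqP|aI].
  by rewrite -[X in _ == X](raddf0 (\pi_{ideal_quot I})%qT) -Quotient.idealrBE subr0.
by apply/eqP; rewrite -[X in _ == X](raddf0 (\pi_{ideal_quot I})%qT) -Quotient.idealrBE subr0.
Qed.

Lemma quotient_field (A : comUnitRingType) (u : A) :
  (forall a, a \isn't a GRing.unit <-> a \in dvds u) ->
  exists (K : fieldType) (pi : {rmorphism A -> K}),
    (forall b, exists a, pi a = b) /\ forall a, pi a = 0 <-> a \in dvds u.
Proof.
move=> uP; have u1 : 1 \notin dvds u by apply/negP => /uP; rewrite unitr1.
have [B [pi [pi_sur pi_ker]]] := quotient_ring u1.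
have inv_ex (x : B) : exists y, (x = 0 -> y = 0) /\ (x != 0 -> y * x = 1).
  have [a <-] := pi_sur x; have [->|a0] := eqVneq (pi a) 0; first by exists 0.
  have ua : a \is a GRing.unit.
    by apply: contraNT a0 => /uP/pi_ker ->.
  exists (pi a^-1); split=> [/eqP|_]; first by rewrite (negPf a0).
  by rewrite -rmorphM mulVr // rmorph1.
have [inv invP] := choice inv_ex.
have inv0 : inv 0 = 0 by apply: (invP 0).1.
have mulVf x : x != 0 -> inv x * x = 1 by apply: (invP x).2.
pose K : fieldType := HB.pack (GRing.ComNzRing.sort B) (GRing.ComNzRing_isField.Build B mulVf inv0).
by exists K, pi.
Qed.

(** Over [K], the gcd of [f] and ['X^p - c%:P] is a scalar multiple of a power of ['X - b%:P] with
    exponent [0 < k < p]. Its coefficients lie in [F], the one below the top gives [b *+ k], and [k]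
    is invertible. *)
Lemma purely_inseparable (F K : fieldType) (iota : {rmorphism F -> K}) (p : nat)
    (f : {poly F}) (b : K) (c : F) :
  prime p -> p%:R = 0 :> K -> b ^+ p = iota c -> f != 0 -> (size f <= p)%N ->
  root (map_poly iota f) b -> exists y, b = iota y.
Proof.
move=> p_pr p0 bc f0 fp fb.
pose g := gcdp f ('X^p - c%:P).
have pP0 : p%:R = 0 :> {poly K} by rewrite -polyC_natr p0.
have XpE : map_poly iota ('X^p - c%:P) = ('X - b%:P) ^+ p.
  rewrite rmorphB /= map_polyXn map_polyC /= -bc exprD_carry //.
  rewrite pP0 mul0r addr0; congr (_ + _).
  have /dvdsP[y] := frob_opp p_pr (b%:P : {poly K}).
  by rewrite pP0 mul0r => /subr0_eq ->; rewrite polyC_exp.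
have [k kp gE] : exists2 k, (k <= p)%N & map_poly iota g %= ('X - b%:P) ^+ k.
  by apply/dvdp_exp_XsubCP; rewrite -XpE gcdp_map dvdp_gcdr.
move/eqpf_eq: gE => [u u0 gE].
have gb : root (map_poly iota g) b.
  rewrite gcdp_map root_gcd fb XpE /root horner_exp hornerXsubC subrr expr0n.
  by rewrite gtn_eqF ?prime_gt0 ?eqxx.
have k_gt0 : (0 < k)%N.
  case: k gE {kp} => // gE; move: gb.
  by rewrite gE expr0 /root hornerZ hornerC mulr1 (negPf u0).
have kltp : (k < p)%N.
  have : (size g <= size f)%N by apply: dvdp_leq; rewrite ?dvdp_gcdl.
  rewrite -(size_map_poly iota g) gE size_scale // size_exp_XsubC.
  by move=> /leq_trans; apply.
have gk : iota g`_k = u.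
  rewrite -coef_map gE coefZ.
  have := monicP (monic_exp k (monicXsubC b)); rewrite lead_coefE size_exp_XsubC => ->.
  by rewrite mulr1.
have gk1 : iota g`_k.-1 = - (u * (b *+ k)).
  rewrite -coef_map gE coefZ.
  have := @coefPn_prod_XsubC K (nseq k b).
  rewrite size_nseq !big_nseq iter_mulr_1 iter_addr_0 -lt0n => -> //.
  by rewrite mulrN.
have k0 : k%:R != 0 :> K.
  have pK : p \in [pchar K] by rewrite inE p_pr p0 eqxx.
  by rewrite -(dvdn_pcharf pK) gtnNdvd.
exists (- (g`_k.-1 / (g`_k * k%:R))).
rewrite rmorphN fmorph_div rmorphM rmorph_nat gk gk1 mulNr opprK -[b *+ k]mulr_natr.
by rewrite [u * (_ * _)]mulrCA mulfK // mulf_neq0.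
Qed.

Section Subfield.
Variables (K : fieldType) (S : divringClosed K).

Inductive subfield := Subfield x & x \in S.
Definition subfield_val u := let: Subfield x _ := u in x.

HB.instance Definition _ := [isSub for subfield_val].
HB.instance Definition _ := [Choice of subfield by <:].
HB.instance Definition _ := [SubChoice_isSubUnitRing of subfield by <:].
HB.instance Definition _ := [SubNzRing_isSubComNzRing of subfield by <:].
HB.instance Definition _ := [SubComUnitRing_isSubIntegralDomain of subfield by <:].
HB.instance Definition _ := [SubIntegralDomain_isSubField of subfield by <:].

(** Makes the subset [S] a field type of its own, so that polynomial gcds can be taken over it. *)
Lemma divring_closed_subfield :
  exists (F : fieldType) (iota : {rmorphism F -> K}), forall x, x \in S <-> exists y, iota y = x.
Proof.
exists subfield, val => x; split=> [xS|[y <-]]; last exact: valP.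
by exists (Subfield xS).
Qed.

End Subfield.

Lemma carry_rmorph (A B : comNzRingType) (psi : {rmorphism A -> B}) p x y :
  psi (carry p x y) = carry p (psi x) (psi y).
Proof.
by rewrite rmorph_sum; apply: eq_bigr => i _; rewrite rmorphMn rmorphM !rmorphXn.
Qed.

(** * Partial lifts of Frobenius and Zorn's lemma *)

Section FrobeniusLift.
Variables (p : nat) (V : comUnitRingType) (B : comNzRingType) (psi : {rmorphism V -> B}).
Hypotheses (p_pr : prime p) (p_reg : nonzerodivisor (p%:R : V)).
Hypothesis unitV : forall a : V, a \isn't a GRing.unit <-> a \in dvds p%:R.
Hypothesis pp0 : p%:R * p%:R = 0 :> B.

Lemma mulp_dvds (x : B) : x \in dvds p%:R -> p%:R * x = 0.
Proof. by move=> /dvdsP[y ->]; rewrite mulrA pp0 mul0r. Qed.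

Lemma mulp_congr (x y : B) : x - y \in dvds p%:R -> p%:R * x = p%:R * y.
Proof. by move=> /mulp_dvds; rewrite mulrBr => /subr0_eq. Qed.

Lemma frob_congr_eq (x y : B) : x - y \in dvds p%:R -> x ^+ p = y ^+ p.
Proof.
by move=> /(frob_congr p_pr)/dvdsP[z]; rewrite expr2 pp0 mul0r => /subr0_eq.
Qed.

(** These values are forced: a lift sends [a ^+ p] to [(psi a ^+ p) ^+ p] and [p * c] to
    [p * psi c ^+ p], because [p * p = 0] in [B]. Both components are the ghost component
    [x ^+ p + p * y] of a Witt vector of length 2, at [(a, c)] and at its image under [psi] and
    [p]-th powers. *)
Definition frob_base (a c : V) : V * B :=
  (a ^+ p + p%:R * c, (psi a ^+ p) ^+ p + p%:R * psi c ^+ p).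

(* The graphs of the partial lifts of Frobenius along [psi].                  *)
Record partial_lift (G : set (V * B)) : Prop := PartialLift {
  lift_base : forall a c, G (frob_base a c);
  lift_add : forall e e', G e -> G e' -> G (e + e');
  lift_mul : forall e e', G e -> G e' -> G (e * e');
  lift_frob : forall e, G e -> e.2 - psi e.1 ^+ p \in dvds p%:R;
  lift_fun : forall e e', G e -> G e' -> e.1 = e'.1 -> e.2 = e'.2 }.

Lemma dvdp_pow (a : V) k : a ^+ k \in dvds p%:R -> a \in dvds p%:R.
Proof. by move=> /unitV ak; apply/unitV; apply: contra ak => /unitrX. Qed.

(** Addition of Witt vectors of length 2; [frob_base_mul] is their multiplication. *)
Lemma frob_base_add a c b d :
  frob_base a c + frob_base b d = frob_base (a + b) (c + d - carry p a b).
Proof.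
rewrite /frob_base; congr (_, _) => /=; first by rewrite exprD_carry //; ring.
have -> : p%:R * psi (c + d - carry p a b) ^+ p =
    p%:R * psi c ^+ p + p%:R * psi d ^+ p - p%:R * carry p (psi a) (psi b) ^+ p.
  rewrite -!mulrDr -mulrBr rmorphB rmorphD carry_rmorph; apply: mulp_congr.
  apply: dvds_trans (frob_add p_pr _ _) _; rewrite opprD addrACA rpredD ?frob_opp //.
  exact: frob_add.
have -> : p%:R * carry p (psi a) (psi b) ^+ p = p%:R * carry p (psi a ^+ p) (psi b ^+ p).
  by apply: mulp_congr; rewrite dvds_sym carry_frob.
rewrite rmorphD (frob_congr_eq (frob_add p_pr (psi a) (psi b))) exprD_carry //; ring.
Qed.

Lemma frob_base_mul a c b d : frob_base a c * frob_base b d =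
  frob_base (a * b) (a ^+ p * d + b ^+ p * c + p%:R * (c * d)).
Proof.
rewrite /frob_base; congr (_, _) => /=; first by rewrite exprMn; ring.
have -> : p%:R * psi (a ^+ p * d + b ^+ p * c + p%:R * (c * d)) ^+ p =
   p%:R * ((psi a ^+ p) ^+ p * psi d ^+ p + (psi b ^+ p) ^+ p * psi c ^+ p).
  rewrite !rmorphD !rmorphM !rmorphXn rmorph_nat -!exprMn; apply: mulp_congr.
  apply: dvds_trans (frob_add p_pr _ _); apply: dvds_congrX.
  by rewrite addrAC subrr add0r dvds_mull.
have -> : forall x y z t : B, (x + p%:R * y) * (z + p%:R * t) =
    x * z + p%:R * (x * t + z * y) + p%:R * p%:R * (y * t) by move=> *; ring.
by rewrite pp0 mul0r addr0 rmorphM !exprMn.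
Qed.

(** The residue ring of [V] modulo [p] is reduced, so [a] and [a'] agree modulo [p], their [p]-th
    powers agree modulo [p ^+ 2], and regularity of [p] gives that [c] and [c'] agree modulo [p].
    This determines the value because [p * p = 0] in [B]. *)
Lemma frob_base_fun a c a' c' :
  (frob_base a c).1 = (frob_base a' c').1 -> (frob_base a c).2 = (frob_base a' c').2.
Proof.
rewrite /frob_base /= => e.
have aa' : a - a' \in dvds p%:R.
  apply: (@dvdp_pow _ p).
  rewrite (dvds_congr (_ : _ - (a ^+ p - a' ^+ p) \in _)).
    have -> : a ^+ p - a' ^+ p = p%:R * (c' - c) by rewrite mulrBr -[a ^+ p](addrK (p%:R * c)) e; ring.
    exact: dvds_mull.
  apply: dvds_trans (frob_add p_pr _ _) _; rewrite opprD addrACA subrr add0r; exact: frob_opp.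
have := frob_congr p_pr aa' => /dvdsP[s sE].
have cc' : c = c' - p%:R * s.
  apply: subr0_eq; apply: p_reg.
  have -> : p%:R * (c - (c' - p%:R * s)) = p%:R ^+ 2 * s - p%:R * (c' - c) by ring.
  by rewrite -sE mulrBr -[a ^+ p](addrK (p%:R * c)) e; ring.
congr (_ + _).
  apply: frob_congr_eq; rewrite -!rmorphXn -rmorphB sE rmorphM rmorphXn rmorph_nat expr2.
  by rewrite -mulrA dvds_mull.
apply: mulp_congr; apply: dvds_congrX; rewrite cc' rmorphB addrAC subrr add0r rpredN.
by rewrite rmorphM rmorph_nat dvds_mull.
Qed.

Lemma partial_lift_base : partial_lift [set e | exists a c, e = frob_base a c]%classic.
Proof.
split=> [a c|_ _ [a [c ->]] [b [d ->]]|_ _ [a [c ->]] [b [d ->]]|_ [a [c ->]]|_ _ [a [c ->]] [a' [c' ->]]].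
- by exists a, c.
- by eexists; eexists; apply: frob_base_add.
- by eexists; eexists; apply: frob_base_mul.
- rewrite /= rmorphD rmorphM rmorphXn rmorph_nat addrAC rpredD ?dvds_mull //.
  by rewrite dvds_congrX // opprD addrA subrr add0r rpredN dvds_mull.
- exact: frob_base_fun.
Qed.

Lemma maximal_partial_lift : exists G, partial_lift G /\
  forall G', partial_lift G' -> (G `<=` G')%classic -> (G' `<=` G)%classic.
Proof.
pose Q (G : set (V * B)) := G = set0 \/ partial_lift G.
have [F FQ Ftot|G [QG Gmax]] := @Zorn_bigcup _ Q.
  have [[X [FX liftX]]|noX] := pselect (exists X, F X /\ partial_lift X); last first.
    left; rewrite -subset0 => e [X FX Xe].
    by case: (FQ _ FX) => [X0|liftX]; [rewrite X0 in Xe|case: noX; exists X].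
  right; have memF Y e : F Y -> Y e -> partial_lift Y.
    by move=> FY Ye; case: (FQ _ FY) => // Y0; rewrite Y0 in Ye.
  have pairF e e' : (\bigcup_(Y in F) Y)%classic e -> (\bigcup_(Y in F) Y)%classic e' ->
      exists Y, [/\ F Y, partial_lift Y, Y e & Y e'].
    move=> [Y FY Ye] [Z FZ Ze']; have [YZ|ZY] := Ftot _ _ FY FZ.
      by exists Z; split=> //; [apply: memF Ze'|apply: YZ].
    by exists Y; split=> //; [apply: memF Ye|apply: ZY].
  split=> [a c|e e' Fe Fe'|e e' Fe Fe'|e Fe|e e' Fe Fe'].
  - by exists X => //; apply: lift_base.
  - by have [Y [FY liftY Ye Ye']] := pairF _ _ Fe Fe'; exists Y => //; apply: lift_add.
  - by have [Y [FY liftY Ye Ye']] := pairF _ _ Fe Fe'; exists Y => //; apply: lift_mul.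
  - by have [Y [_ liftY Ye _]] := pairF _ _ Fe Fe; apply: (lift_frob liftY).
  - by have [Y [_ liftY Ye Ye']] := pairF _ _ Fe Fe'; apply: (lift_fun liftY).
have liftG : partial_lift G.
  case: QG => // G0; case: (Gmax [set e | exists a c, e = frob_base a c]%classic).
    by rewrite G0; split=> [//|/(_ (frob_base 0 0))]; apply; exists 0, 0.
  by right; apply: partial_lift_base.
exists G; split=> // G' liftG' GG'; apply: contrapT => G'G.
by apply: (Gmax G'); [split|right].
Qed.

Section PartialLift.
Variable G : set (V * B).
Hypothesis liftG : partial_lift G.

Lemma lift0 : G 0.
Proof.
have := lift_base liftG 0 0.
by rewrite /frob_base !rmorph0 !expr0p // !mulr0 !addr0.
Qed.

Lemma lift1 : G 1.
Proof.
have := lift_base liftG 1 0.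
by rewrite /frob_base rmorph0 rmorph1 !expr1n expr0p // !mulr0 !addr0.
Qed.

Lemma liftX e k : G e -> G (e ^+ k).
Proof.
move=> Ge; elim: k => [|k IHk]; first by rewrite expr0; apply: lift1.
by rewrite exprS; apply: lift_mul.
Qed.

Lemma liftN e : G e -> G (- e).
Proof.
move=> Ge; rewrite -mulN1r; apply: lift_mul => //.
have [p2|podd] := even_prime p_pr.
  (* For [p = 2], [-1 = 1 + 2 * (-1)] is in the base, with value [1 + 2 = 3], which is [-1] because
     [4 = 0] in [B]. *)
  have := lift_base liftG 1 (- 1); rewrite /frob_base !rmorphN rmorph1 !expr1n p2.
  rewrite sqrrN expr1n mulr1 mulrN mulr1; congr (G _); congr (_, _); first by ring.
  by move: pp0; rewrite p2 => e4; rewrite -[LHS]subr0 -e4; ring.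
have := lift_base liftG (- 1) 0; rewrite /frob_base rmorphN rmorph1 rmorph0.
have sgn (A : comNzRingType) : (-1) ^+ p = -1 :> A by rewrite -signr_odd podd.
by rewrite !sgn expr0p // !mulr0 !addr0.
Qed.

Lemma lift_dvds e : G e -> e.1 \in dvds p%:R -> exists2 c, e.1 = p%:R * c & e.2 = p%:R * psi c ^+ p.
Proof.
move=> Ge /dvdsP[c ec]; exists c => //.
have := lift_fun liftG Ge (lift_base liftG 0 c).
by rewrite /frob_base /= rmorph0 !expr0p // !add0r; apply.
Qed.

Variable b : V.
Hypothesis Gb : forall y, ~ G (b, y).

(* Modulo [p] the domain of [G] is a subfield containing all [p]-th powers,   *)
(* over which [b] has degree [p].                                             *)
Lemma lift_independent (d : nat -> V * B) : (forall j, G (d j)) ->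
  \sum_(j < p) (d j).1 * b ^+ j \in dvds p%:R ->
  forall j, (j < p)%N -> (d j).1 \in dvds p%:R.
Proof.
move=> Gd db; have [K [pi [pi_sur pi_ker]]] := quotient_field unitV.
have piP0 : p%:R = 0 :> K by rewrite -(rmorph_nat pi); apply/pi_ker/dvdsP; exists 1; rewrite mulr1.
pose S : {pred K} := [pred x | `[< exists2 e, G e & pi e.1 = x >]].
have SP x : reflect (exists2 e, G e & pi e.1 = x) (x \in S) by apply: asboolP.
have Sclosed : divring_closed S.
  split=> [|x y|x y].
  - by apply/SP; exists 1; [apply: lift1|rewrite rmorph1].
  - move=> /SP[e Ge <-] /SP[e' Ge' <-]; apply/SP; exists (e - e'); last by rewrite rmorphB.
    by apply: lift_add => //; apply: liftN.
  move=> /SP[e Ge <-] /SP[e' Ge' <-]; apply/SP.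
  have [a aE] := pi_sur (pi e'.1)^-1.
  (* A quotient [x / y] equals [x * y ^+ p.-1 * y^-1 ^+ p], and [p]-th powers are always in the
     domain. *)
  exists (e * e' ^+ p.-1 * frob_base a 0).
    by do 2?apply: lift_mul => //; [apply: liftX|apply: lift_base].
  have fstX k : (e' ^+ k).1 = e'.1 ^+ k by rewrite -[LHS]/(fst _) rmorphXn.
  rewrite /= fstX mulr0 addr0 !rmorphM !rmorphXn /= aE -mulrA; congr (_ * _).
  have [->|y0] := eqVneq (pi e'.1) 0; first by rewrite invr0 (expr0p _ p_pr) mulr0.
  by rewrite -[in _^-1 ^+ p](prednK (prime_gt0 p_pr)) exprS mulrCA -exprMn divff // expr1n mulr1.
pose S' : divringClosed K := HB.pack S (GRing.isDivringClosed.Build K S Sclosed).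
have [F [iota iotaP]] := divring_closed_subfield S'.
have /choice[y yE] j : exists y, iota y = pi (d j).1.
  by apply/iotaP/SP; exists (d j).
have [c cE] : exists c, iota c = pi b ^+ p.
  apply/iotaP/SP; exists (frob_base b 0); first exact: lift_base.
  by rewrite /= mulr0 addr0 rmorphXn.
pose f := \poly_(j < p) y j.
have fE : map_poly iota f = \poly_(j < p) pi (d j).1.
  apply/polyP => j; rewrite coef_map !coef_poly.
  by case: ifP => _; [exact: yE|exact: rmorph0].
have fb : root (map_poly iota f) (pi b).
  rewrite fE /root horner_poly; apply/eqP.
  transitivity (pi (\sum_(j < p) (d j).1 * b ^+ j)); last exact/pi_ker.
  by rewrite rmorph_sum; apply: eq_bigr => j _; rewrite rmorphM rmorphXn.
have [f0 j jp|f0] := eqVneq f 0.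
  by apply/pi_ker; rewrite -yE; have := congr1 (fun g : {poly F} => g`_j) f0;
    rewrite /f coef_poly jp coef0 => ->; rewrite rmorph0.
have [x xE] := purely_inseparable p_pr piP0 (esym cE) f0 (size_poly _ _) fb.
(* Now [b] differs from a point of the domain by some [p * z]; adding [frob_base 0 z] gives a point
   of [G] above [b], contrary to [Gb]. *)
have /SP[e Ge ebE] : pi b \in S by apply/iotaP; exists x.
have /dvdsP[z zE] : b - e.1 \in dvds p%:R by apply/pi_ker; rewrite rmorphB ebE subrr.
have : G (e + frob_base 0 z) by apply: lift_add => //; apply: lift_base.
have -> : e + frob_base 0 z = (b, (e + frob_base 0 z).2).
  by rewrite [LHS]surjective_pairing /= expr0p // add0r -zE addrC subrK.
by move/Gb.
Qed.

Let beta : V * B := (b, psi b ^+ p).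

Lemma betaX j : beta ^+ j = (b ^+ j, (psi b ^+ p) ^+ j).
Proof. by elim: j => [|j IHj]; rewrite ?expr0 // !exprS IHj. Qed.

(** Exponents below [p] are enough, since [beta ^+ p = frob_base b 0] already lies in [G]. *)
Definition adjoin : set (V * B) :=
  [set e | exists2 d : nat -> V * B, forall j, G (d j) & e = \sum_(j < p) d j * beta ^+ j]%classic.

Lemma adjoin_monomial e j : G e -> adjoin (e * beta ^+ j).
Proof.
move=> Ge; pose x := e * (beta ^+ p) ^+ (j %/ p).
have Gx : G x.
  apply: lift_mul => //; apply: liftX.
  have -> : beta ^+ p = frob_base b 0; last exact: lift_base.
  by rewrite betaX /frob_base rmorph0 expr0p // !mulr0 !addr0.
have jp : (j %% p < p)%N by rewrite ltn_mod prime_gt0.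
exists (fun l => if l == (j %% p)%N then x else 0) => [l|].
  by case: eqP => // _; apply: lift0.
rewrite (bigD1 (Ordinal jp)) //= eqxx big1 ?addr0 => [|l].
  by rewrite /x -exprM -mulrA -exprD mulnC -divn_eq.
by rewrite -(inj_eq val_inj) /= => /negPf ->; rewrite mul0r.
Qed.

Lemma adjoinD e e' : adjoin e -> adjoin e' -> adjoin (e + e').
Proof.
move=> [d Gd ->] [d' Gd' ->]; exists (fun j => d j + d' j) => [j|].
  exact: lift_add.
by rewrite -big_split; apply: eq_bigr => j _; rewrite mulrDl.
Qed.

(** The issue is single-valuedness. In a relation between the powers of [b], [lift_independent]
    makes every coefficient some [p * c j], with value [p * psi (c j) ^+ p]. Cancelling [p] gives a
    relation between the [c j], and the total value is [p] times the [p]-th power of its image,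
    hence zero. *)
Lemma partial_lift_adjoin : partial_lift adjoin.
Proof.
have sumG (J : finType) (F : J -> V * B) : (forall j, adjoin (F j)) -> adjoin (\sum_j F j).
  move=> adF; apply: (big_ind adjoin) => //; last exact: adjoinD.
  by rewrite -[0](mul0r (beta ^+ 0)); apply: adjoin_monomial; exact: lift0.
split=> [a c|e e'|e e' [d Gd ->] [d' Gd' ->]|e [d Gd ->]|e e' [d Gd eE] [d' Gd' e'E] ee'].
- by rewrite -[frob_base a c]mulr1 -(expr0 beta); apply: adjoin_monomial; exact: lift_base.
- exact: adjoinD.
- rewrite mulr_suml; apply: (sumG) => i; rewrite mulr_sumr; apply: (sumG) => j.
  by rewrite mulrACA -exprD; apply: adjoin_monomial; exact: lift_mul.
- pose C (e : V * B) := e.2 - psi e.1 ^+ p \in dvds p%:R.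
  have CM x y : C x -> C y -> C (x * y).
    by move=> Cx Cy; rewrite /C /= rmorphM exprMn dvds_congrM.
  apply: (big_ind C) => [|x y Cx Cy|j _].
  + by rewrite /C /= rmorph0 expr0p // subrr rpred0.
  + rewrite /C /= rmorphD dvds_sym; apply: dvds_trans (frob_add p_pr _ _) _.
    by rewrite dvds_sym opprD addrACA rpredD.
  apply: (CM); first exact: (lift_frob liftG (Gd j)).
  elim: (j : nat) => [|l IHl]; last by rewrite exprS; apply: CM => //; rewrite /C subrr rpred0.
  by rewrite /C expr0 /= rmorph1 expr1n subrr rpred0.
pose u j := d j - d' j.
have Gu j : G (u j) by apply: lift_add => //; apply: liftN.
have uE : e - e' = \sum_(j < p) u j * beta ^+ j.
  by rewrite eE e'E -sumrB; apply: eq_bigr => j _; rewrite mulrBl.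
have u1 : \sum_(j < p) (u j).1 * b ^+ j = 0.
  transitivity (e - e').1; last by rewrite /= ee' subrr.
  rewrite uE -[RHS]/(fst _) rmorph_sum; apply: eq_bigr => j _.
  by rewrite rmorphM /= betaX.
have udvds j : (j < p)%N -> (u j).1 \in dvds p%:R.
  by apply: lift_independent => //; rewrite u1 rpred0.
have /choice[c cP] j : exists c, (j < p)%N -> (u j).1 = p%:R * c /\ (u j).2 = p%:R * psi c ^+ p.
  have [jp|_] := ltnP j p; last by exists 0.
  by have [c c1 c2] := lift_dvds (Gu j) (udvds j jp); exists c.
have c0 : \sum_(j < p) c j * b ^+ j = 0.
  apply: p_reg; rewrite mulr_sumr -[RHS]u1; apply: eq_bigr => j _.
  by rewrite (cP j (ltn_ord j)).1 mulrA.
apply: subr0_eq; transitivity (e - e').2 => //.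
rewrite uE -[LHS]/(snd _) rmorph_sum.
transitivity (p%:R * psi (\sum_(j < p) c j * b ^+ j) ^+ p); last first.
  by rewrite c0 rmorph0 expr0p // mulr0.
rewrite rmorph_sum (mulp_congr (frob_sum p_pr _ _ _)) mulr_sumr.
apply: eq_bigr => j _.
rewrite -[LHS]/((u j).2 * (beta ^+ j).2) betaX (cP j (ltn_ord j)).2.
by rewrite /= rmorphM rmorphXn exprMn exprAC mulrA.
Qed.

End PartialLift.

Lemma frobenius_lift : exists phi : {rmorphism V -> B},
  forall a, phi a - psi a ^+ p \in dvds p%:R.
Proof.
have [G [liftG Gmax]] := maximal_partial_lift.
have /choice[phi phiP] b : exists y, G (b, y).
  apply: contrapT => noy; have Gb y : ~ G (b, y) by move=> Gy; apply: noy; exists y.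
  apply: (Gb (psi b ^+ p)); apply: (Gmax _ (partial_lift_adjoin liftG Gb)).
    move=> e Ge; rewrite -[e]mulr1 -(expr0 (b, psi b ^+ p)).
    exact: adjoin_monomial.
  rewrite -[(b, _)]mul1r -[X in _ * X]expr1; apply: adjoin_monomial => //.
  exact: lift1.
have phiD : zmod_morphism phi.
  move=> x y; apply: (lift_fun liftG (phiP (x - y)) (lift_add liftG (phiP x) (liftN liftG (phiP y)))).
  by [].
have phiM : monoid_morphism phi.
  split; first exact: (lift_fun liftG (phiP 1) (lift1 liftG)).
  by move=> x y; apply: (lift_fun liftG (phiP (x * y)) (lift_mul liftG (phiP x) (phiP y))).
pose Phi : {rmorphism V -> B} := HB.pack phi (GRing.isZmodMorphism.Build V B phi phiD)
  (GRing.isMonoidMorphism.Build V B phi phiM).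
by exists Phi => a; apply: (lift_frob liftG (phiP a)).
Qed.

End FrobeniusLift.

(** * Extending the lift to polynomials and their localization *)

Lemma localization_lift (M : comNzRingType) (R : comUnitRingType) (B : comNzRingType)
    (Q : set M) (loc : {rmorphism M -> R}) (phi : {rmorphism M -> B}) :
  is_localization_at Q loc -> (forall s, ~ Q s -> exists y, phi s * y = 1) ->
  exists phi' : {rmorphism R -> B}, forall m, phi' (loc m) = phi m.
Proof.
move=> [loc_unit loc_frac loc_ker] phi_inv.
have phi_cancel s x y : ~ Q s -> x * phi s = y * phi s -> x = y.
  by move=> /phi_inv[z sz] xy; rewrite -[x]mulr1 -[y]mulr1 -sz !mulrA xy.
have loc_eq b b' : loc b = loc b' -> phi b = phi b'.
  move=> bb'; have [|s Qs sb] := loc_ker (b - b'); first by rewrite rmorphB bb' subrr.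
  apply: (phi_cancel s) => //; apply: subr0_eq.
  by rewrite -mulrBl -rmorphB -rmorphM mulrC sb rmorph0.
have /choice[f fP] a : exists y, forall b s, ~ Q s -> a * loc s = loc b -> y * phi s = phi b.
  have [b [s [Qs ->]]] := loc_frac a; have [z sz] := phi_inv s Qs.
  exists (phi b * z) => b' s' Qs' e; apply: (phi_cancel s) => //.
  transitivity (phi b * phi s'); last rewrite -!rmorphM.
    by rewrite -[RHS]mulr1 -sz; ring.
  apply: loc_eq; rewrite !rmorphM -e.
  by rewrite mulrAC divrK // loc_unit.
have fE a : exists b s, [/\ ~ Q s, a * loc s = loc b & f a * phi s = phi b].
  have [b [s [Qs aE]]] := loc_frac a; exists b, s.
  have e : a * loc s = loc b by rewrite aE divrK // loc_unit.
  by split=> //; apply: fP.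
have f_zmod : zmod_morphism f.
  move=> a a'; have [b [s [Qs ab fab]]] := fE a; have [b' [s' [Qs' ab' fab']]] := fE a'.
  have [b3 [s3 [Qs3 ab3 fab3]]] := fE (a - a').
  apply: (phi_cancel s3) => //; apply: (phi_cancel s) => //; apply: (phi_cancel s') => //.
  transitivity (phi (b3 * s * s')); first by rewrite !rmorphM fab3.
  transitivity (phi ((b * s' - b' * s) * s3)); last first.
    by rewrite rmorphM rmorphB !rmorphM -fab -fab'; ring.
  by apply: loc_eq; rewrite !rmorphM rmorphB !rmorphM -ab -ab' -ab3; ring.
have f_monoid : monoid_morphism f.
  split.
    have [b [s [Qs ab fab]]] := fE 1; apply: (phi_cancel s) => //.
    by rewrite fab mul1r; apply: loc_eq; rewrite -ab mul1r.
  move=> a a'; have [b [s [Qs ab fab]]] := fE a; have [b' [s' [Qs' ab' fab']]] := fE a'.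
  have [b3 [s3 [Qs3 ab3 fab3]]] := fE (a * a').
  apply: (phi_cancel s3) => //; apply: (phi_cancel s) => //; apply: (phi_cancel s') => //.
  transitivity (phi (b3 * s * s')); first by rewrite !rmorphM fab3.
  transitivity (phi (b * b' * s3)); last by rewrite !rmorphM -fab -fab'; ring.
  by apply: loc_eq; rewrite !rmorphM -ab -ab' -ab3; ring.
pose phi' : {rmorphism R -> B} := HB.pack f (GRing.isZmodMorphism.Build R B f f_zmod)
  (GRing.isMonoidMorphism.Build R B f f_monoid).
exists phi' => m; have [b [s [Qs ab fab]]] := fE (loc m); apply: (phi_cancel s) => //.
by rewrite [LHS]fab -rmorphM; apply: loc_eq; rewrite -ab rmorphM.
Qed.

Lemma frobenius_lift_mpoly (p n : nat) (V : comUnitRingType) (B : comNzRingType)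
    (psi : {rmorphism {mpoly V[n]} -> B}) :
  prime p -> nonzerodivisor (p%:R : V) ->
  (forall a : V, a \isn't a GRing.unit <-> a \in dvds p%:R) ->
  p%:R * p%:R = 0 :> B ->
  exists phi : {rmorphism {mpoly V[n]} -> B}, forall m, phi m - psi m ^+ p \in dvds p%:R.
Proof.
move=> p_pr p_reg unitV pp0.
have [phi phiP] := frobenius_lift (psi \o @mpolyC n V) p_pr p_reg unitV pp0.
exists (mmap phi (fun i => psi 'X_i ^+ p)) => m.
pose C m := mmap phi (fun i => psi 'X_i ^+ p) m - psi m ^+ p \in dvds p%:R.
have CM x y : C x -> C y -> C (x * y).
  by move=> Cx Cy; rewrite /C !rmorphM exprMn dvds_congrM.
have CX x k : C x -> C (x ^+ k).
  move=> Cx; elim: k => [|k IHk]; last by rewrite exprS; apply: CM.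
  by rewrite /C expr0 !rmorph1 expr1n subrr rpred0.
rewrite -/(C m) (mpolyE m); apply: (big_ind C) => [|x y Cx Cy|i _].
- by rewrite /C !rmorph0 expr0p // subrr rpred0.
- rewrite /C !rmorphD dvds_sym; apply: dvds_trans (frob_add p_pr _ _) _.
  by rewrite dvds_sym opprD addrACA rpredD.
rewrite -mul_mpolyC; apply: (CM); first by rewrite /C /= mmapC; apply: phiP.
rewrite mpolyXE_id; apply: (big_ind C) => [|x y|j _]; last 1 first.
- by apply: CX; rewrite /C /= mmapX mmap1U subrr rpred0.
- by rewrite /C !rmorph1 expr1n subrr rpred0.
- exact: CM.
Qed.

Lemma frobenius_lift_localization (p n : nat) (V : comUnitRingType) (R : comUnitRingType)
    (B : comNzRingType) (Q : set {mpoly V[n]}) (loc : {rmorphism {mpoly V[n]} -> R})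
    (pi : {rmorphism R -> B}) :
  prime p -> nonzerodivisor (p%:R : V) ->
  (forall a : V, a \isn't a GRing.unit <-> a \in dvds p%:R) ->
  is_localization_at Q loc -> p%:R * p%:R = 0 :> B ->
  exists phi : {rmorphism R -> B}, forall a, phi a - pi a ^+ p \in dvds p%:R.
Proof.
move=> p_pr p_reg unitV locP pp0; have [loc_unit loc_frac _] := locP.
have [phi phiP'] := frobenius_lift_mpoly (pi \o loc) p_pr p_reg unitV pp0.
have phiP m : phi m - pi (loc m) ^+ p \in dvds p%:R by apply: phiP'.
have phi_inv s : ~ Q s -> exists y, phi s * y = 1.
  move=> /loc_unit s_unit; pose z := pi (loc s)^-1 ^+ p.
  have /dvdsP[t zt] : phi s * z - 1 \in dvds p%:R.
    have e : pi (loc s) ^+ p * z = 1 by rewrite -exprMn -rmorphM mulrV // rmorph1 expr1n.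
    by rewrite -[X in _ - X]e -mulrBl dvdsMl //; apply: phiP.
  (* As [phi s * z = 1 + p * t] and [p * p = 0], the factor [1 - p * t] completes the inverse. *)
  exists (z * (1 - p%:R * t)).
  rewrite mulrA -[phi s * z](subrK 1) zt.
  transitivity (1 - p%:R * p%:R * t ^+ 2); first by ring.
  by rewrite pp0 mul0r subr0.
have [phi' phiE] := localization_lift locP phi_inv.
exists phi' => a; have [b [s [Qs ->]]] := loc_frac a.
have [y sy] := phi_inv s Qs; have s_unit := loc_unit s Qs.
set a' := loc b / loc s; have ab : a' * loc s = loc b by rewrite divrK.
rewrite -[_ - _]mulr1 -[X in _ * X \in _]sy mulrA dvdsMl // mulrBl -phiE -rmorphM ab phiE.
rewrite dvds_sym; apply: dvds_trans (_ : _ - pi a' ^+ p * pi (loc s) ^+ p \in _) _.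
  by rewrite -mulrBr dvdsM // phiE; apply: phiP.
by rewrite -exprMn -rmorphM ab dvds_sym phiE; apply: phiP.
Qed.

(** * Flatness of Frobenius modulo p *)

Section FrobeniusFree.
Variables (A : comNzRingType) (p : nat).

Definition frob_independent (L : finType) (b : L -> A) := forall c : L -> A,
  \sum_l b l * c l ^+ p \in dvds p%:R -> forall l, c l \in dvds p%:R.

Definition frob_span (L : finType) (b : L -> A) (x : A) :=
  exists c : L -> A, x - \sum_l b l * c l ^+ p \in dvds p%:R.

(* The equational form of the flatness of Frobenius on [A / p A].            *)
Definition frob_free := forall s : seq A, exists (L : finType) (b : L -> A),
  frob_independent b /\ forall x, x \in s -> frob_span b x.

Hypothesis p_pr : prime p.

Lemma frob_spanD (L : finType) (b : L -> A) x y :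
  frob_span b x -> frob_span b y -> frob_span b (x + y).
Proof.
move=> [c xc] [d yd]; exists (fun l => c l + d l).
apply: dvds_trans (_ : _ - (\sum_l b l * c l ^+ p + \sum_l b l * d l ^+ p) \in _) _.
  by rewrite opprD addrACA rpredD.
rewrite -big_split -sumrB; apply: rpred_sum => l _ /=.
by rewrite -mulrDr -mulrBr dvdsM // dvds_sym frob_add.
Qed.

Lemma frob_span0 (L : finType) (b : L -> A) : frob_span b 0.
Proof.
exists (fun=> 0); rewrite big1 ?subr0 ?rpred0 // => l _.
by rewrite expr0p ?mulr0.
Qed.

End FrobeniusFree.

(** A basis over the [p]-th powers of the residue field is built greedily: an [x] outside the span
    can be added, because a relation with a unit coefficient at [x] would put [x] in the span. *)
Lemma frob_free_field (V : comUnitRingType) p : prime p ->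
  (forall a : V, a \isn't a GRing.unit <-> a \in dvds p%:R) -> frob_free V p.
Proof.
move=> p_pr unitV.
suff H (s : seq V) : exists k (b : 'I_k -> V), frob_independent p b /\ forall x, x \in s -> frob_span p b x.
  by move=> s; have [k [b bP]] := H s; exists 'I_k, b.
elim: s => [|x s [k [b [b_ind b_span]]]].
  by exists 0%N, (fun=> 0); split=> // c _ [].
have [xb|xb] := pselect (frob_span p b x).
  by exists k, b; split=> // y; rewrite inE => /orP[/eqP ->|/b_span].
pose b' (i : 'I_k.+1) := oapp b x (unlift ord0 i).
have sumE (c : 'I_k.+1 -> V) : \sum_i b' i * c i ^+ p =
    x * c ord0 ^+ p + \sum_i b i * c (lift ord0 i) ^+ p.
  by rewrite big_ord_recl /b' unlift_none; congr (_ + _); apply: eq_bigr => i _; rewrite liftK.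
exists k.+1, b'; split=> [c|y].
  rewrite sumE => cp.
  have [c0|c0] := boolP (c ord0 \in dvds p%:R).
    have cp0 : c ord0 ^+ p \in dvds p%:R.
      by rewrite -[X in _ ^+ X](prednK (prime_gt0 p_pr)) exprS dvdsMl.
    move: cp; rewrite rpredDl ?dvdsM // => /(b_ind (fun i => c (lift ord0 i))) cl i.
    by case: (unliftP ord0 i) => [j ->|->].
  have cu : c ord0 \is a GRing.unit by apply: contraNT c0 => /unitV.
  case: xb; exists (fun i => - (c (lift ord0 i) / c ord0)).
  have -> : x = x * c ord0 ^+ p * (c ord0)^-1 ^+ p by rewrite -mulrA -exprMn divrr // expr1n mulr1.
  apply: dvds_trans (_ : _ - (- \sum_i b i * c (lift ord0 i) ^+ p) * (c ord0)^-1 ^+ p \in _) _.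
    by rewrite -mulrBl opprK dvdsMl.
  rewrite mulNr mulr_suml -sumrN -sumrB; apply: rpred_sum => i _.
  rewrite -mulrA -exprMn -mulrN -mulrBr dvdsM // dvds_sym; exact: frob_opp.
rewrite inE => /orP[/eqP ->|/b_span[c yc]].
  exists (fun i => if i == ord0 then 1 else 0); rewrite sumE eqxx expr1n mulr1 big1.
    by rewrite addr0 subrr rpred0.
  by move=> i _; rewrite /= expr0p ?mulr0.
exists (fun i => oapp c 0 (unlift ord0 i)).
rewrite sumE unlift_none /= expr0p // mulr0 add0r.
by rewrite (eq_bigr (fun i => b i * c i ^+ p)) // => i _; rewrite liftK.
Qed.

(** Writing [y / s] as [y * s ^+ p.-1 / s ^+ p] makes the denominator a [p]-th power, so a family
    that serves the numerators over [M] serves the fractions as well. *)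
Lemma frob_free_localization (M : comNzRingType) (R : comUnitRingType) p (Q : set M)
    (loc : {rmorphism M -> R}) :
  prime p -> is_localization_at Q loc -> frob_free M p -> frob_free R p.
Proof.
move=> p_pr [loc_unit loc_frac loc_ker] freeM s.
have p_gt0 := prime_gt0 p_pr.
have loc_dvds x : x \in dvds p%:R -> loc x \in dvds p%:R.
  by move=> /dvdsP[y ->]; rewrite rmorphM rmorph_nat dvds_mull.
have /choice[num numP] a : exists bs : M * M, loc bs.2 \is a GRing.unit /\ a = loc bs.1 / loc bs.2.
  by have [b [t [Qt ->]]] := loc_frac a; exists (b, t); split=> //; apply: loc_unit.
have [L [b [b_ind b_span]]] := freeM [seq (num x).1 * (num x).2 ^+ p.-1 | x <- s].
exists L, (loc \o b); split=> [c cp l|x xs]; last first.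
  have [c xc] := b_span _ (map_f _ xs); have [u_unit xE] := numP x.
  exists (fun l => loc (c l) / loc (num x).2).
  have -> : \sum_l (loc \o b) l * (loc (c l) / loc (num x).2) ^+ p =
      loc (\sum_l b l * c l ^+ p) / loc (num x).2 ^+ p.
    rewrite rmorph_sum mulr_suml; apply: eq_bigr => l _.
    by rewrite rmorphM rmorphXn exprMn exprVn mulrA.
  have xE' : x = loc ((num x).1 * (num x).2 ^+ p.-1) / loc (num x).2 ^+ p.
    rewrite {1}xE rmorphM rmorphXn -[in _ ^- p](prednK p_gt0) exprS invrM ?unitrX //.
    by rewrite mulrA mulrK ?unitrX.
  by rewrite {1}xE' -mulrBl dvdsMl // -rmorphB loc_dvds.
pose t := \prod_l (num (c l)).2.
have t_unit : loc t \is a GRing.unit.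
  rewrite rmorph_prod; apply: (big_ind (fun x => x \is a GRing.unit)) => [|x y xu yu|i _].
  - exact: unitr1.
  - by rewrite unitrM xu.
  - exact: (numP _).1.
have /choice[c' cE] i : exists c', c i * loc t = loc c'.
  have [u_unit {1}->] := numP (c i).
  rewrite /t (bigD1 i) //= rmorphM mulrA divrK // -rmorphM.
  by eexists.
have [d [e [Qe]]] := loc_frac (loc t ^+ p * (projT1 (cid (dvdsP _ _ cp)))).
case: cid => r /= rE dE.
have [|e' Qe' e'0] := loc_ker (e * (\sum_l b l * c' l ^+ p) - p%:R * d).
  rewrite rmorphB !rmorphM rmorph_nat rmorph_sum.
  rewrite (eq_bigr (fun l => (loc \o b) l * c l ^+ p * loc t ^+ p)); last first.
    by move=> i _; rewrite rmorphM rmorphXn -cE exprMn mulrA.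
  rewrite -mulr_suml rE.
  have -> : loc d = loc t ^+ p * r * loc e by rewrite dE divrK // loc_unit.
  by ring.
(* The cleared relation holds in [M] only up to the factor [e' * e]; multiplying by its [p]-th power
   lets the factor be absorbed into the coefficients. *)
pose g := e' * e.
have g_unit : loc g \is a GRing.unit by rewrite rmorphM unitrM !loc_unit.
have : loc (c' l) \in dvds p%:R.
  rewrite -[loc (c' l)](mulKr g_unit) dvdsM // -rmorphM loc_dvds //.
  apply: (b_ind (fun l => g * c' l)).
  rewrite (eq_bigr (fun l => g ^+ p * (b l * c' l ^+ p))) => [|i _]; last by rewrite exprMn mulrCA.
  rewrite -mulr_sumr -(prednK p_gt0) exprSr -mulrA dvdsM // prednK //.
  move: e'0; rewrite mulrBr mulrA => /subr0_eq ->; rewrite mulrCA; exact: dvds_mull.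
by rewrite -cE -[c l in X in _ -> X](mulrK t_unit); apply: dvdsMl.
Qed.

Section FrobeniusFreeMpoly.
Variables (V : comNzRingType) (p n : nat).
Hypothesis p_pr : prime p.
Let p_gt0 := prime_gt0 p_pr.

Lemma dvds_mcoeff (C : {mpoly V[n]}) k :
  C \in dvds k%:R <-> forall m, C@_m \in dvds k%:R.
Proof.
split=> [/dvdsP[D ->] m|Ck]; first by apply/dvdsP; exists D@_m; rewrite !mulr_natl mcoeffMn.
rewrite (mpolyE C); apply: rpred_sum => m _; have /dvdsP[c ->] := Ck m.
by apply/dvdsP; exists (c *: 'X_[m]); rewrite !mulr_natl scalerMnl.
Qed.

Definition frobX (C : {mpoly V[n]}) := \sum_(m <- msupp C) C@_m ^+ p *: 'X_[(m *+ p)%MM].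

Lemma frobXP C : C ^+ p - frobX C \in dvds p%:R.
Proof.
rewrite {1}(mpolyE C); apply: dvds_trans (frob_sum p_pr _ _ _) _.
rewrite -sumrB; apply: rpred_sum => m _.
by rewrite exprZn mpolyXn subrr rpred0.
Qed.

Definition low_mnm (a : {ffun 'I_n -> 'I_p}) : 'X_{1..n} := [multinom (a i : nat) | i < n].
Definition mnm_mod (m : 'X_{1..n}) : {ffun 'I_n -> 'I_p} := [ffun i => Ordinal (ltn_pmod (m i) p_gt0)].
Definition mnm_div (m : 'X_{1..n}) : 'X_{1..n} := [multinom (m i %/ p)%N | i < n].

Lemma mnm_divn_eq m : (low_mnm (mnm_mod m) + mnm_div m *+ p)%MM = m.
Proof.
by apply/mnmP => i; rewrite mnmDE mulmnE !mnmE ffunE /= addnC -divn_eq.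
Qed.

Lemma mnm_divn_inj a m a' m' :
  ((low_mnm a + m *+ p)%MM == (low_mnm a' + m' *+ p)%MM) = (a == a') && (m == m').
Proof.
apply/eqP/andP => [e|[/eqP -> /eqP ->]] //.
have ei i : (a i + m i * p = a' i + m' i * p)%N.
  by have := congr1 (fun m : 'X_{1..n} => m i) e; rewrite !mnmDE !mulmnE !mnmE.
split; apply/eqP.
  apply/ffunP => i; apply: val_inj; have := congr1 (modn^~ p) (ei i).
  by rewrite /= (addnC (a i)) (addnC (a' i)) !modnMDl !modn_small.
apply/mnmP => i; have := congr1 (divn^~ p) (ei i).
by rewrite /= (addnC (a i)) (addnC (a' i)) !divnMDl // !divn_small // !addn0.
Qed.

Lemma mcoeff_frobX b a C a' m' :
  (b *: 'X_[low_mnm a] * frobX C)@_(low_mnm a' + m' *+ p) =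
  if a == a' then b * C@_m' ^+ p else 0.
Proof.
rewrite /frobX mulr_sumr raddf_sum /=.
have E m : (b *: 'X_[low_mnm a] * (C@_m ^+ p *: 'X_[(m *+ p)%MM]))@_(low_mnm a' + m' *+ p) =
    if (a == a') && (m == m') then b * C@_m ^+ p else 0.
  rewrite -scalerAl -scalerAr -mpolyXD scalerA mcoeffZ mcoeffX mnm_divn_inj.
  by case: ifP; rewrite ?mulr1 ?mulr0.
rewrite (eq_bigr _ (fun m _ => E m)); case: eqP => _ /=; last by rewrite big1.
have [m'C|m'C] := boolP (m' \in msupp C).
  by rewrite (bigD1_seq m') //= eqxx big1 ?addr0 // => m /negPf ->.
rewrite big1_seq => [|m /andP[_ mC]].
  by rewrite (memN_msupp_eq0 m'C) expr0p // mulr0.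
by case: eqP => // mm; rewrite -mm mC in m'C.
Qed.

(** Division of exponents by [p] writes each monomial uniquely as a [p]-th power times a monomial
    with exponents below [p]; the latter, times a family for the coefficients, form the new
    family. *)
Lemma frob_free_mpoly : frob_free V p -> frob_free {mpoly V[n]} p.
Proof.
move=> freeV s; pose cs := flatten [seq [seq x@_m | m <- msupp x] | x : {mpoly V[n]} <- s].
have [L [b [b_ind b_span]]] := freeV cs.
exists (L * {ffun 'I_n -> 'I_p})%type, (fun la => b la.1 *: 'X_[low_mnm la.2]).
split=> [c cp [l a]|x xs]; last first.
  rewrite (mpolyE x) big_seq_cond; apply: big_ind => [|y z|m]; [exact: frob_span0|exact: frob_spanD|].
  rewrite andbT => mx; have [|d xd] := b_span x@_m.
    by apply/flattenP; exists [seq x@_m | m <- msupp x]; apply: map_f.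
  exists (fun la => if la.2 == mnm_mod m then d la.1 *: 'X_[mnm_div m] else 0).
  rewrite -(pair_bigA _ (fun l a => b l *: 'X_[low_mnm a] *
    (if a == mnm_mod m then d l *: 'X_[mnm_div m] else 0) ^+ p)) /=.
  rewrite (eq_bigr (fun l => (b l * d l ^+ p) *: 'X_[m])) => [|l _].
    rewrite -scaler_suml -scalerBl -mul_mpolyC dvdsMl //.
    by move/dvdsP: xd => [y ->]; rewrite mpolyCM mpolyC_nat dvds_mull.
  rewrite (bigD1 (mnm_mod m)) //= eqxx big1 ?addr0 => [|a /negPf ->]; last by rewrite expr0p // mulr0.
  by rewrite exprZn mpolyXn -scalerAl -scalerAr -mpolyXD mnm_divn_eq scalerA.
apply/dvds_mcoeff => m.
apply: (b_ind (fun l => (c (l, a))@_m)).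
have : \sum_la b la.1 *: 'X_[low_mnm la.2] * frobX (c la) \in dvds p%:R.
  rewrite (dvds_congr (_ : _ - \sum_la b la.1 *: 'X_[low_mnm la.2] * c la ^+ p \in _)) //.
  rewrite -sumrB; apply: rpred_sum => la _.
  by rewrite -mulrBr dvdsM // dvds_sym frobXP.
(* This coefficient receives only the terms with residue [a], leaving a relation in [V] between the
   coefficients at [m]. *)
move=> /dvds_mcoeff/(_ (low_mnm a + m *+ p)%MM); rewrite raddf_sum /=.
rewrite (eq_bigr (fun la => if la.2 == a then b la.1 * (c (la.1, la.2))@_m ^+ p else 0)); last first.
  by move=> [l' a'] _; rewrite mcoeff_frobX.
rewrite -(pair_bigA _ (fun l a' => if a' == a then b l * (c (l, a'))@_m ^+ p else 0)) /=.
rewrite (eq_bigr (fun l => b l * (c (l, a))@_m ^+ p)) // => l' _.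
by rewrite (bigD1 a) //= eqxx big1 ?addr0 // => a' /negPf ->.
Qed.

End FrobeniusFreeMpoly.

Lemma kd_rmorph (A B : comNzRingType) (phi : {rmorphism A -> B}) N (u : 'I_N -> A) m T :
  phi (kd u m T) = kd (phi \o u) (phi \o m) T.
Proof.
rewrite rmorph_sum; apply: eq_bigr => j _.
by rewrite !rmorphM rmorphXn rmorphN1.
Qed.

Lemma kd_frob (A : comNzRingType) p N (u : 'I_N -> A) m T : prime p ->
  kd u m T ^+ p - kd (upow u p) (fun S => m S ^+ p) T \in dvds p%:R.
Proof.
move=> p_pr; apply: dvds_trans (frob_sum p_pr _ _ _) _.
by rewrite -sumrB; apply: rpred_sum => j _; rewrite /upow -exprMn frob_sign.
Qed.

(** * Cofinality of the Frobenius pullbacks *)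

Section FrobeniusPullback.
Variables (R B : comNzRingType) (p N : nat) (n : int).
Hypotheses (p_pr : prime p) (freeR : frob_free R p).
Variables (pi phi : {rmorphism R -> B}).
Hypothesis pi_sur : forall x, exists a, pi a = x.
Hypothesis pi_ker : forall a, pi a = 0 <-> a \in dvds (p%:R ^+ 2).
Hypothesis phi_frob : forall a, phi a - pi a ^+ p \in dvds p%:R.

Lemma pi_dvds a : pi a \in dvds p%:R -> a \in dvds p%:R.
Proof.
move=> /dvdsP[t at']; have [c ct] := pi_sur t.
have /pi_ker/dvdsP[d ad] : pi (a - p%:R * c) = 0.
  by rewrite rmorphB rmorphM rmorph_nat ct at' subrr.
by apply/dvdsP; exists (c + p%:R * d); rewrite mulrDr mulrA -expr2 -ad addrC subrK.
Qed.

Lemma dvds_pi a : a \in dvds p%:R -> pi a \in dvds p%:R.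
Proof. by move=> /dvdsP[c ->]; rewrite rmorphM rmorph_nat dvds_mull. Qed.

(** Modulo [p], [v] is [upow u p], so expanding [m] as a sum of [b l * c l ^+ p] expands its
    differential in [p]-th powers of the differentials of the [c l]. Independence makes each [c l] a
    cocycle modulo [p]; its lift is carried over by [phi], which sends multiples of [p ^+ 2] to
    zero. *)
Lemma koszul_lifts_frobenius (u v : 'I_N -> R) :
  (forall j, pi (v j) = phi (u j)) -> koszul_lifts p%:R u n -> koszul_lifts p%:R v n.
Proof.
move=> vE lift m dm.
have v_u j : v j - u j ^+ p \in dvds p%:R.
  by apply: pi_dvds; rewrite rmorphB vE rmorphXn.
have [L [b [b_ind b_span]]] := freeR (codom m).
have /choice[c cP] T : exists c, m T - \sum_l b l * c l ^+ p \in dvds p%:R.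
  by apply: b_span; apply: codom_f.
have dc l (T : {set 'I_N}) : #|T|%:Z = n + 1 -> kd u (fun S => c S l) T \in dvds p%:R.
  move=> Tn; apply: (b_ind (fun l => kd u (fun S => c S l) T)).
  rewrite (dvds_congr (_ : _ - kd (upow u p) (fun S => \sum_l b l * c S l ^+ p) T \in _)).
    rewrite (dvds_congr (_ : _ - kd v m T \in _)) ?dm //.
    by apply: dvds_kd_congr => j _; rewrite dvds_sym.
  rewrite kd_sum -sumrB; apply: rpred_sum => l' _.
  by rewrite kdZ -mulrBr dvdsM // kd_frob.
have /choice[M MP] l : exists M : {set 'I_N} -> R,
    (forall T : {set 'I_N}, #|T|%:Z = n -> M T - c T l \in dvds p%:R) /\
    (forall T : {set 'I_N}, #|T|%:Z = n + 1 -> kd u M T \in dvds (p%:R ^+ 2)).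
  by have [M M1 M2] := lift _ (dc l); exists M.
have /choice[m' m'E] (T : {set 'I_N}) : exists y, pi y = \sum_l pi (b l) * phi (M l T).
  exact: pi_sur.
exists m' => T Tn.
  apply: dvds_trans (_ : _ - \sum_l b l * c T l ^+ p \in _) _; last by rewrite dvds_sym.
  apply: pi_dvds; rewrite rmorphB m'E rmorph_sum -sumrB; apply: rpred_sum => l _.
  rewrite rmorphM rmorphXn -mulrBr dvdsM //; apply: dvds_trans (phi_frob _) _.
  by rewrite dvds_congrX // -rmorphB dvds_pi // (MP l).1.
apply/pi_ker; rewrite kd_rmorph.
rewrite (kd_eq (v := phi \o u) (m' := fun S => \sum_l pi (b l) * phi (M l S))) => [|j _|j _]; last 2 first.
- by rewrite /= vE.
- by rewrite /= m'E.
rewrite kd_sum big1 // => l _; rewrite kdZ -[kd _ _ _]/(kd (phi \o u) (phi \o M l) T).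
rewrite -kd_rmorph; have /dvdsP[x ->] := (MP l).2 T Tn.
have pp0 : p%:R ^+ 2 = 0 :> B.
  by rewrite -(rmorph_nat pi) -rmorphXn; apply/pi_ker/dvdsP; exists 1; rewrite mulr1.
by rewrite rmorphM rmorphXn rmorph_nat pp0 mul0r mulr0.
Qed.

Lemma koszul_lifts_frobenius_iter (u : 'I_N -> R) e : koszul_lifts p%:R u n ->
  exists2 v, koszul_lifts p%:R v n & forall j, v j - u j ^+ (p ^ e) \in dvds p%:R.
Proof.
move=> lift; elim: e => [|e [v liftv vu]].
  by exists u => // j; rewrite expn0 expr1 subrr rpred0.
have /choice[w wE] j : exists y, pi y = phi (v j) by apply: pi_sur.
exists w; first exact: koszul_lifts_frobenius liftv.
move=> j; apply: dvds_trans (_ : _ - v j ^+ p \in _) _.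
  by apply: pi_dvds; rewrite rmorphB wE rmorphXn.
by rewrite expnS mulnC exprM dvds_congrX.
Qed.

Lemma liftable_frobenius (u : 'I_N -> R) :
  koszul_lifts p%:R u n -> liftable p%:R u finset.setT n.
Proof.
move=> lift a; have p_gt0 := prime_gt0 p_pr; have p_gt1 := prime_gt1 p_pr.
have [v liftv vu] := koszul_lifts_frobenius_iter a lift.
set q := (p ^ a)%N in vu; have aq : (a <= q)%N by rewrite ltnW // ltn_expl.
have qqp : (q <= q * p)%N by rewrite leq_pmulr.
(* Chosen so that [a + b = q * p]. A shift along [u] goes from [a] to [q], where [v] takes over
   modulo [p]; a shift along [v] by [p.-1] then reaches [v ^+ p], which equals [u ^+ (q * p)] modulo
   [p ^+ 2]. *)
exists (q * p - a)%N => m dm.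
have [T Tn|M Mm dM] := liftv (shift_exp u (q - a) m).
  rewrite (dvds_congr (_ : _ - kd (upow u q) (shift_exp u (q - a) m) T \in _)).
    by rewrite -{1}(subnKC aq) kd_shift dvdsM // dm // finset.subsetT.
  by apply: dvds_kd_congr => j _; rewrite ?subrr ?rpred0 // vu.
exists (shift_exp v p.-1 M) => T _ Tn.
  apply: dvds_trans (_ : _ - gprod (upow u q) T ^+ p.-1 * shift_exp u (q - a) m T \in _) _.
    by rewrite dvds_congrM ?Mm // dvds_congrX // dvds_congr_prod.
  rewrite /gprod /upow prodrXl -/(gprod u T) /shift_exp mulrA -exprM -exprD.
  have -> : (q * p.-1 + (q - a) = q * p - a)%N by rewrite -subn1 mulnBr muln1 addnBA // subnK.
  by rewrite subrr rpred0.
rewrite subnKC ?(leq_trans aq) //.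
rewrite (dvds_congr (_ : _ - kd (upow v (1 + p.-1)) (shift_exp v p.-1 M) T \in _)).
  rewrite kd_shift dvdsM //; have := dM T Tn.
  by rewrite (kd_eq (v := upow v 1) (m' := M)).
apply: dvds_kd_congr => j _; last by rewrite subrr rpred0.
by rewrite /upow add1n prednK // exprM frob_congr // dvds_sym.
Qed.

End FrobeniusPullback.

(** * Free extensions *)

Section FreeExtension.
Variables (R S : comNzRingType) (iota : {rmorphism R -> S}) (L : finType) (e : L -> S).
Hypothesis e_span : forall x, exists c, x = \sum_l e l * iota (c l).
Hypothesis e_free : forall c, \sum_l e l * iota (c l) = 0 -> forall l, c l = 0.

Lemma free_inj c c' : \sum_l e l * iota (c l) = \sum_l e l * iota (c' l) -> forall l, c l = c' l.
Proof.
move=> cc l; apply: subr0_eq; apply: (e_free (c := fun l => c l - c' l)).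
rewrite (eq_bigr (fun l => e l * iota (c l) - e l * iota (c' l))) => [|i _].
  by rewrite sumrB cc subrr.
by rewrite rmorphB mulrBr.
Qed.

Lemma free_dvds u c :
  \sum_l e l * iota (c l) \in dvds (iota u) <-> forall l, c l \in dvds u.
Proof.
split=> [/dvdsP[x]|cu].
  have [d ->] := e_span x; rewrite mulr_sumr => cd l; apply/dvdsP; exists (d l).
  apply: (free_inj (c := c) (c' := fun l => u * d l)); rewrite cd; apply: eq_bigr => i _.
  by rewrite rmorphM mulrCA.
apply: rpred_sum => l _; have /dvdsP[y ->] := cu l.
by rewrite rmorphM mulrCA dvds_mull.
Qed.

Lemma free_nonzerodivisor u : nonzerodivisor u -> nonzerodivisor (iota u).
Proof.
move=> u_reg x; have [c ->] := e_span x; rewrite mulr_sumr => uc.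
rewrite big1 // => l _; rewrite (u_reg (c l)) ?rmorph0 ?mulr0 //.
apply: (e_free (c := fun l => u * c l)); rewrite -[RHS]uc; apply: eq_bigr => i _.
by rewrite rmorphM mulrCA.
Qed.

Lemma kd_free N (u : 'I_N -> R) (c : {set 'I_N} -> L -> R) T :
  kd (iota \o u) (fun S => \sum_l e l * iota (c S l)) T =
  \sum_l e l * iota (kd u (fun S => c S l) T).
Proof. by rewrite kd_sum; apply: eq_bigr => l _; rewrite kdZ kd_rmorph. Qed.

(** Differentials and transition maps have entries from [R], so they act on each coordinate
    separately. In [liftable] the exponent [b] precedes the cochain, hence is common to all
    coordinates. *)
Lemma liftable_free N (u : 'I_N -> R) p W n :
  liftable p u W n -> liftable (iota p) (iota \o u) W n.
Proof.
move=> lift a; have [b liftb] := lift a; exists b => m dm.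
have upowE k : upow (iota \o u) k = iota \o upow u k.
  by apply/funext => j; rewrite /upow /= rmorphXn.
have gprodE T : gprod (iota \o u) T = iota (gprod u T) by rewrite rmorph_prod.
have /choice[c cE] T : exists c, m T = \sum_l e l * iota (c l) by apply: e_span.
have mE : m = fun T => \sum_l e l * iota (c T l) by apply/funext.
have /choice[M MP] l : exists M : {set 'I_N} -> R,
    (forall T : {set 'I_N}, T \subset W -> #|T|%:Z = n ->
       M T - shift_exp u b (fun S => c S l) T \in dvds p) /\
    (forall T : {set 'I_N}, T \subset W -> #|T|%:Z = n + 1 ->
       kd (upow u (a + b)) M T \in dvds (p ^+ 2)).
  have [T TW Tn|M M1 M2] := liftb (fun S => c S l); last by exists M.
  have := dm T TW Tn; rewrite mE upowE kd_free => /free_dvds.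
  exact.
exists (fun T => \sum_l e l * iota (M l T)) => T TW Tn; last first.
  rewrite upowE (kd_free _ (fun T l => M l T)) -rmorphXn; apply/free_dvds => l.
  exact: (MP l).2.
rewrite /shift_exp mE mulr_sumr -sumrB.
rewrite (eq_bigr (fun l => e l * iota (M l T - gprod u T ^+ b * c T l))) => [|l _].
  by apply/free_dvds => l; apply: (MP l).1.
by rewrite gprodE rmorphB rmorphM rmorphXn mulrBr [in RHS]mulrCA.
Qed.

End FreeExtension.

Lemma ideal_gen1 (A : comNzRingType) (x y : A) : ideal_gen [set x]%classic y <-> y \in dvds x.
Proof.
split=> [|/dvdsP[a ->]].
  move=> /(_ [set z | z \in dvds x]%classic); apply.
  split=> [|_ ->]; last by rewrite -[X in _ X]mulr1; apply: dvds_mull.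
  split=> [|a b|a b]; [exact: rpred0|exact: rpredD|exact: dvdsM].
by move=> K [[_ _ KM] Kx]; rewrite mulrC; apply/KM/Kx.
Qed.

(** Remainders of division by the monic [h] span, and a nonzero multiple of [h] cannot have smaller
    size than [h]. *)
Lemma monic_quotient_basis (R : comUnitRingType) (S : comUnitRingType) (h : {poly R})
    (q : {rmorphism {poly R} -> S}) :
  h \is monic -> is_quotient_by (ideal_gen [set h])%classic q ->
  let e (l : 'I_(size h).-1) := q 'X^l in let iota := q \o polyC in
  (forall x, exists c, x = \sum_l e l * iota (c l)) /\
  (forall c, \sum_l e l * iota (c l) = 0 -> forall l, c l = 0).
Proof.
move=> h_monic [q_sur q_ker] e iota.
have h_gt0 : (0 < size h)%N by rewrite size_poly_gt0 monic_neq0.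
have qE c : \sum_l e l * iota (c l) = q (\sum_(l < (size h).-1) c l *: 'X^l).
  by rewrite rmorph_sum; apply: eq_bigr => l _; rewrite /e /iota /= -rmorphM mulrC mul_polyC.
split=> [x|c].
  have [f <-] := q_sur x.
  have -> : q f = q (Pdiv.Ring.rmodp f h).
    rewrite {1}(Pdiv.RingMonic.rdivp_eq h_monic f) rmorphD.
    by rewrite (q_ker _).2 ?add0r //; apply/ideal_gen1/dvdsP; eexists; apply: mulrC.
  exists (fun l : 'I_(size h).-1 => (Pdiv.Ring.rmodp f h)`_l); rewrite qE; congr (q _).
  rewrite -[LHS]coefK poly_def; set r := Pdiv.Ring.rmodp f h.
  have : (size r <= (size h).-1)%N by rewrite -ltnS prednK // Pdiv.Ring.ltn_rmodp monic_neq0.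
  move=> /(big_ord_widen _ (fun l => r`_l *: 'X^l)) ->.
  rewrite big_mkcond; apply: eq_bigr => l _; case: ltnP => // rl.
  by rewrite nth_default // scale0r.
rewrite qE => /q_ker/ideal_gen1/dvdsP[g gE].
have sz : (size (\sum_(l < (size h).-1) c l *: 'X^l)%R < size h)%N.
  rewrite -[X in (_ < X)%N]prednK // ltnS; apply: (leq_trans (size_sum _ _ _)).
  apply/bigmax_leqP => l _; apply: (leq_trans (size_scale_leq _ _)).
  by rewrite size_polyXn.
have g0 : g = 0.
  apply/eqP; apply: contraTT sz => g0; rewrite gE -leqNgt size_monicM //.
  by move: g0; rewrite -size_poly_gt0; case: (size g) => // k _; rewrite addnS leq_addr.
move: gE; rewrite g0 mulr0 => e0 l.
have := congr1 (fun f : {poly R} => f`_l) e0; rewrite coef0 coef_sum.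
rewrite (bigD1 l) //= coefZ coefXn eqxx mulr1 big1 ?addr0 // => i il.
by rewrite coefZ coefXn (inj_eq val_inj) eq_sym (negPf il) mulr0.
Qed.

(** * Generated ideals and the localization at the maximal ideal *)

Section IdealGeneration.
Variable A : comNzRingType.
Local Open Scope classical_set_scope.
Implicit Types (G K : set A).

Lemma ideal_gen_min G K : is_ideal K -> G `<=` K -> ideal_gen G `<=` K.
Proof. by move=> idK GK x; apply. Qed.

Lemma sub_ideal_gen G : G `<=` ideal_gen G.
Proof. by move=> x Gx K [_]; apply. Qed.

Lemma ideal_gen_is_ideal G : is_ideal (ideal_gen G).
Proof.
split=> [K [[K0 _ _] _] //|x y Gx Gy K idK|a x Gx K idK]; have [[_ KD KM] _] := idK.
  by apply: KD; [apply: Gx|apply: Gy].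
by apply: KM; apply: Gx.
Qed.

Lemma span_mod_is_ideal p N (u : 'I_N -> A) W : is_ideal [set x | span_mod p u W x].
Proof.
by split=> [|x y|a x]; [apply/span_mod_dvds/rpred0|apply: span_modD|apply: span_modM].
Qed.

Lemma ideal_gen_span_mod p N (u : 'I_N -> A) x :
  ideal_gen (ideal_gen (range u) `|` [set p]) x -> span_mod p u finset.setT x.
Proof.
move: x; apply: ideal_gen_min; first exact: span_mod_is_ideal.
move=> x [|->]; last by apply: span_mod_dvds; rewrite -[X in X \in _]mulr1 dvds_mull.
move: x; apply: ideal_gen_min; first exact: span_mod_is_ideal.
by move=> _ [j _ <-]; apply: span_mod_gen; rewrite finset.in_setT.
Qed.

End IdealGeneration.

Section LocalizationAtPrime.
Local Open Scope classical_set_scope.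
Variables (V : idomainType) (p n : nat) (R : comUnitRingType).
Variables (Q : set {mpoly V[n]}) (loc : {rmorphism {mpoly V[n]} -> R}).
Hypotheses (p0 : p%:R != 0 :> V) (Q_ideal : is_ideal Q) (locP : is_localization_at Q loc).

Lemma nonzerodivisor_localization : nonzerodivisor (p%:R : R).
Proof.
have [loc_unit loc_frac loc_ker] := locP; have [Q0 _ _] := Q_ideal.
move=> r; have [b [s [Qs ->]]] := loc_frac r => pb.
have [|s' Qs'] := loc_ker (p%:R * b).
  apply: (mulIr (_ : (loc s)^-1 \is a GRing.unit)); first by rewrite unitrV loc_unit.
  by rewrite mul0r rmorphM rmorph_nat -mulrA.
have s'0 : s' != 0 by apply: contra_notN Qs' => /eqP ->.
have pV : p%:R != 0 :> {mpoly V[n]} by rewrite -mpolyC_nat mpolyC_eq0.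
by move=> /eqP; rewrite !mulf_eq0 (negPf s'0) (negPf pV) => /eqP ->; rewrite rmorph0 mul0r.
Qed.

(** Ensures that [R / p ^+ 2] is a nonzero ring, as its type demands. *)
Lemma localization_proper : Q p%:R -> 1 \notin dvds (p%:R ^+ 2 : R).
Proof.
move=> Qp; have [loc_unit loc_frac loc_ker] := locP; have [Q0 _ QM] := Q_ideal.
apply/negP => /dvdsP[r]; have [b [s [Qs ->]]] := loc_frac r => e.
have [|s' Qs'] := loc_ker (s - p%:R ^+ 2 * b).
  rewrite rmorphB rmorphM rmorphXn rmorph_nat; apply/eqP; rewrite subr_eq0 -[loc s]mul1r.
  by rewrite [X in X * loc s]e -mulrA divrK ?loc_unit.
have s'0 : s' != 0 by apply: contra_notN Qs' => /eqP ->.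
move=> /eqP; rewrite mulf_eq0 (negPf s'0) subr_eq0 => /eqP sE; apply: Qs.
by rewrite sE mulrC expr2 mulrA; apply: QM.
Qed.

End LocalizationAtPrime.

Local Open Scope classical_set_scope.

Theorem corollary3 (p n : nat) (V : idomainType)
  (R : comUnitRingType) (loc : {rmorphism {mpoly V[n]} -> R})
  (t : nat) (f : 'I_t -> R) (I : set R) (i : nat)
  (S : comUnitRingType) (h : {poly R}) (q : {rmorphism {poly R} -> S}) :
  prime p ->
  is_dvr V -> mixed_char V p -> @nonunits V = ideal_gen [set p%:R] ->
  is_localization_at (ideal_gen (p%:R |` range (fun j : 'I_n => 'X_j))) loc ->
  I = ideal_gen (range f) ->
  ~ assZ p (cohomology (koszul f R^o) i%:Z) ->
  ~ assZ p (cohomology (koszul f R^o) (i%:Z + 1)) ->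
  eisenstein h -> is_quotient_by (ideal_gen [set h]) q ->
  regular_local S -> ramified S p ->
  forall J : set S, is_ideal J ->
  radical (ideal_gen (J `|` [set p%:R])) =
    radical (ideal_gen (ideal_gen ((fun a => q a%:P) @` I) `|` [set p%:R])) ->
  forall (k : nat) (g : 'I_k -> S), J = ideal_gen (range g) ->
  forall x : loc_cohomology g (modquot p%:R S^o) (i%:Z - 1),
    @bockstein S k g p%:R (i%:Z - 1) x = 0.
Proof.
move=> p_pr _ [_ charV _] nonunitsV locP IE notass _ [h_monic _ _ _] qP _ _ J _ radJ k g JE.
have unitV (a : V) : a \isn't a GRing.unit <-> a \in dvds p%:R.
  by rewrite -ideal_gen1 -nonunitsV.
have p0 : p%:R != 0 :> V.
  by apply/eqP => /charV p0; move: p_pr; rewrite p0.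
have pV_reg : nonzerodivisor (p%:R : V).
  by move=> a /eqP; rewrite mulf_eq0 (negPf p0) => /eqP.
have Q_ideal := ideal_gen_is_ideal (p%:R |` range (fun j : 'I_n => 'X_j : {mpoly V[n]})).
have pR_reg := nonzerodivisor_localization p0 Q_ideal locP.
have Qp := @sub_ideal_gen _ (p%:R |` range (fun j : 'I_n => 'X_j : {mpoly V[n]})) _ (or_introl erefl).
have [B [pi [pi_sur pi_ker]]] := quotient_ring (localization_proper Q_ideal locP Qp).
have pp0 : p%:R * p%:R = 0 :> B.
  by rewrite -expr2 -(rmorph_nat pi) -rmorphXn; apply/pi_ker/dvdsP; exists 1; rewrite mulr1.
have [phi phi_frob] := frobenius_lift_localization pi p_pr pV_reg unitV locP pp0.
have freeR : frob_free R p.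
  exact/(frob_free_localization p_pr locP)/frob_free_mpoly/frob_free_field.
(* The obstruction to lifting cocycles of degree [i - 1] is a [p]-torsion class in degree [i]. *)
have lift_f : koszul_lifts p%:R f (i%:Z - 1).
  by apply: koszul_lifts_torsionfree; rewrite ?subrK.
have liftR := liftable_frobenius p_pr freeR pi_sur pi_ker phi_frob lift_f.
have [e_span e_free] := monic_quotient_basis h_monic qP.
pose iota : {rmorphism R -> S} := q \o polyC.
have pE : iota p%:R = p%:R by rewrite rmorph_nat.
have liftS := liftable_free (iota := iota) e_span e_free liftR.
have pS_reg := free_nonzerodivisor (iota := iota) e_span e_free pR_reg.
rewrite pE in liftS pS_reg.
(* What remains is the equality of radicals, as two statements: every [iota (f j)] has a power in
   [J + p S], and every [g j] has one in [I S + p S]. *)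
apply: bockstein_eq0 => //; apply: liftable_radical liftS => // j.
  have : radical (ideal_gen (J `|` [set p%:R])) ((iota \o f) j).
    rewrite radJ; exists 1%N; apply: sub_ideal_gen; left; apply: sub_ideal_gen.
    by exists (f j) => //; rewrite IE; apply: sub_ideal_gen; exists j.
  by move=> [c jc]; exists c; apply: ideal_gen_span_mod; rewrite -JE.
have : radical (ideal_gen (J `|` [set p%:R])) (g j).
  by exists 1%N; apply: sub_ideal_gen; left; rewrite JE; apply: sub_ideal_gen; exists j.
rewrite radJ => -[c jc]; exists c; apply: ideal_gen_span_mod; move: jc.
apply: ideal_gen_min; first exact: ideal_gen_is_ideal.
move=> x [xI|->]; last by apply: sub_ideal_gen; right.
apply: sub_ideal_gen; left; move: x xI.
apply: ideal_gen_min; first exact: ideal_gen_is_ideal.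
have [I0 ID IM] := ideal_gen_is_ideal (range (iota \o f)).
rewrite IE => _ [a Ia <-]; move: a Ia.
apply: (@ideal_gen_min _ _ [set a | ideal_gen (range (iota \o f)) (iota a)]).
  split=> [|a b|a b] /=; rewrite ?rmorph0 ?rmorphD ?rmorphM //.
    exact: ID.
  exact: IM.
by move=> _ [l _ <-]; apply: sub_ideal_gen; exists l.
Qed.
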